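(* Let $X$ be a smooth complex projective curve of genus $2$ and let $E$ be a stable rank $2$ vector bundle on $X$ with trivial determinant, lying outside of the six odd Gunning planes $\Pi_{[w_i]}$. Then there are exactly two line subbundles $L^+,L^-\simeq\mathcal{O}_X(-\mathrm{K}_X)$ of $E$ that are invariant under the lift $h$ of the hyperelliptic involution. The two parabolic structures $\boldsymbol p$ and $\boldsymbol p'$ on $E$ over the Weierstrass points are precisely the fibres over the Weierstrass points of the two line subbundles $L^\pm$.
   Context: $\iota:X\to X$ is the hyperelliptic involution and $w_i$ ($i=0,1,r,s,t,\infty$) are the six Weierstrass points. For a stable $E$ with trivial determinant there is an isomorphism $h:E\to\iota^*E$, unique up to sign, that is involutive ($\iota^*h\circ h=\mathrm{id}_E$) and acts on each Weierstrass fibre $E_{w_i}$ with the two eigenvalues $+1$ and $-1$ (it conjugates every trace-free holomorphic connection $\nabla$ on $E$ to $\iota^*\nabla$). The parabolic structure $\boldsymbol p$ (resp. $\boldsymbol p'$) is the collection of the $(+1)$-eigenlines (resp. $(-1)$-eigenlines) of $h$ in the fibres $E_{w_i}$. A stable rank $2$ vector bundle $E$ on $X$ with trivial determinant lies on the odd Gunning plane $\Pi_{[w_i]}$ if $h^0(X,E\otimes\mathcal{O}_X([w_i]))>0$. *)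

(* Defs.v *)
From HB Require Import structures.
From mathcomp Require Import all_boot all_order all_algebra.
From mathcomp Require Import boolp classical_sets functions cardinality.
From mathcomp Require Import freeg.

Set Implicit Arguments.
Unset Strict Implicit.
Unset Printing Implicit Defensive.

Import Order.TTheory GRing.Theory Num.Theory.
Local Open Scope classical_set_scope.
Local Open Scope ring_scope.

(* ** Curves

   Over an algebraically closed field k, a smooth projective curve X is
   encoded by its function field K = k(X), as an "abstract nonsingular curve"
   (Hartshorne, I.6): the points of X are the normalized discrete valuations
   of K that are trivial on k, and all of them have residue field k. *)

Definition ratfun (k K : fieldType) (c : {rmorphism k -> K}) (x : K) : set K :=
  [set f | exists P Q : {poly k},
     (map_poly c Q).[x] != 0 /\ f = (map_poly c P).[x] / (map_poly c Q).[x]].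

Definition is_function_field (k K : fieldType) (c : {rmorphism k -> K}) :=
  exists x : K,
    (forall P : {poly k}, P != 0 -> (map_poly c P).[x] != 0) /\
    exists (n : nat) (b : 'I_n -> K), forall f : K,
      exists a : 'I_n -> K,
        (forall i, ratfun c x (a i)) /\ f = \sum_(i < n) a i * b i.

Record curve (k : fieldType) := Curve {
  funfield :> fieldType;
  const : {rmorphism k -> funfield};
  curveP : is_function_field const }.

Arguments const {k} c.

(* [ord_zero] only fixes the junk value at 0, so that a point is determined by its
   valuation. *)
Record closed_point (k : fieldType) (X : curve k) := Point {
  ord : X -> int;
  ord_zero : ord 0 = 0;
  ord_mul : forall f g, f != 0 -> g != 0 -> ord (f * g) = ord f + ord g;
  ord_add : forall f g, f != 0 -> g != 0 -> f + g != 0 ->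
           Num.min (ord f) (ord g) <= ord (f + g);
  ord_const : forall c : k, ord (const X c) = 0;
  ord_onto : exists t, ord t = 1 }.

HB.instance Definition _ (k : fieldType) (X : curve k) :=
  gen_eqMixin (closed_point X).
HB.instance Definition _ (k : fieldType) (X : curve k) :=
  gen_choiceMixin (closed_point X).

Section Curve.
Variables (k : fieldType) (X : curve k).
Implicit Types (p : closed_point X) (n : nat).

Definition divisor := {freeg (closed_point X) / int}.

(* The fractional ideal m_p^z; m_p^0 is the local ring at p. *)
Definition mpow p (z : int) : set X := [set f | f = 0 \/ z <= ord p f].
Definition local_ring p : set X := mpow p 0.
Definition maximal_ideal p : set X := mpow p 1.

(* ** Vector bundles

   A vector bundle of rank n on X, trivialized at the generic point, is a
   locally free subsheaf of rank n of the constant sheaf K^n.  It is given by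
   its stalks, which are lattices E_p in K^n, all but finitely many equal to
   O_p^n.  Morphisms of bundles are the K-linear maps between the generic
   fibres that preserve the stalks. *)

Definition sheaf n := closed_point X -> set 'cV[X]_n.

Definition std_stalk n p : set 'cV[X]_n :=
  [set v | forall i, local_ring p (v i 0)].
Arguments std_stalk : clear implicits.

Definition local_frame n (E : sheaf n) p (g : 'M[X]_n) :=
  g \in unitmx /\ E p = [set g *m a | a in std_stalk n p].

Definition vector_bundle n (E : sheaf n) :=
  (forall p, exists g, local_frame E p g) /\
  finite_set [set p | E p <> std_stalk n p].

(* F must span K^n; the generic fibre of G may be a proper subspace of K^m,
   as for a line subbundle of a rank 2 bundle. *)
Definition sheaf_iso n m (F : sheaf n) (G : sheaf m) (A : 'M[X]_(m, n)) :=
  (forall v : 'cV[X]_n, A *m v = 0 -> v = 0) /\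
  (forall p, G p = [set A *m v | v in F p]).

Definition isomorphic n m (F : sheaf n) (G : sheaf m) :=
  exists A : 'M[X]_(m, n), sheaf_iso F G A.

Definition line_bundle (D : divisor) : sheaf 1 :=
  fun p => [set v | mpow p (- coeff p D) (v 0 0)].

(* E (x) O(D), with (E (x) O(D))_p = O(D)_p . E_p *)
Definition twist n (E : sheaf n) (D : divisor) : sheaf n :=
  fun p => [set w | exists f v,
    [/\ mpow p (- coeff p D) f, E p v & w = f *: v]].

(* The top exterior power: v_1 /\ ... /\ v_n is sent to its determinant in K. *)
Definition det_bundle n (E : sheaf n) : sheaf 1 :=
  fun p => [set w | exists M : 'M[X]_n,
    (forall j, E p (col j M)) /\ w = (\det M)%:M].

Definition global_sections n (E : sheaf n) : set 'cV[X]_n :=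
  [set v | forall p, E p v].

Definition has_dim n (V : set 'cV[X]_n) (d : nat) :=
  exists b : 'I_d -> 'cV[X]_n,
    (forall a : 'I_d -> k,
       \sum_(i < d) const X (a i) *: b i = 0 -> forall i, a i = 0) /\
    V = [set v | exists a : 'I_d -> k, v = \sum_(i < d) const X (a i) *: b i].

(* A rank one subsheaf which is locally a direct factor of E. *)
Definition line_subbundle n (E L : sheaf n.+1) :=
  (exists u : 'cV[X]_n.+1, u != 0 /\
     forall p v, L p v -> exists a : X, v = a *: u) /\
  (forall p, exists g : 'M[X]_n.+1, local_frame E p g /\
     L p = [set a *: col 0 g | a in local_ring p]).

Definition line_degree n (L : sheaf n) (d : int) :=
  exists D : divisor, isomorphic (line_bundle D) L /\ deg D = d.

Definition bundle_degree n (E : sheaf n) (d : int) :=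
  line_degree (det_bundle E) d.

Definition trivial_determinant n (E : sheaf n) :=
  isomorphic (line_bundle 0) (det_bundle E).

Definition stable (E : sheaf 2) :=
  forall (L : sheaf 2) (d e : int),
    line_subbundle E L -> line_degree L d -> bundle_degree E e -> d * 2 < e.

(* ** Canonical divisor and genus *)

Definition derivation (D : X -> X) :=
  [/\ forall f g, D (f + g) = D f + D g,
      forall f g, D (f * g) = D f * g + f * D g
    & forall c : k, D (const X c) = 0].

(* KX is the divisor of a nonzero rational differential g dx: its coefficient
   at p is the order of g dx/dt for a uniformizer t at p, where d/dt denotes
   the derivation of K over k sending t to 1. *)
Definition canonical_divisor (KX : divisor) :=
  exists g x : X, g != 0 /\ (forall c : k, x != const X c) /\
    forall p t, ord p t = 1 -> exists ddt : X -> X,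
      [/\ derivation ddt, ddt t = 1 & coeff p KX = ord p (g * ddt x)].

(* g = h^0(X, K_X) *)
Definition genus (g : nat) :=
  exists KX : divisor,
    canonical_divisor KX /\ has_dim (global_sections (line_bundle KX)) g.

(* ** Involutions *)

(* The comorphism f |-> f o iota of an involution iota of X. *)
Record involution := Involution {
  comorphism :> {rmorphism X -> X};
  inv_const : forall c : k, comorphism (const X c) = const X c;
  inv_involutive : involutive comorphism }.

Section InvPoint.
Variables (iota : involution) (p : closed_point X).

Let io (f : X) := ord p (iota f).

Fact io0 : io 0 = 0.
Proof. by rewrite /io rmorph0 ord_zero. Qed.

Fact ioM f g : f != 0 -> g != 0 -> io (f * g) = io f + io g.
Proof. by move=> f0 g0; rewrite /io rmorphM ord_mul ?fmorph_eq0. Qed.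

Fact ioD f g : f != 0 -> g != 0 -> f + g != 0 ->
  Num.min (io f) (io g) <= io (f + g).
Proof.
by move=> f0 g0 fg0; rewrite /io rmorphD ord_add -?rmorphD ?fmorph_eq0.
Qed.

Fact io_const c : io (const X c) = 0.
Proof. by rewrite /io inv_const ord_const. Qed.

Fact io_onto : exists t, io t = 1.
Proof. by have [t pt] := ord_onto p; exists (iota t); rewrite /io inv_involutive. Qed.

(* The image point iota(p): ord_(iota p) f = ord_p (f o iota). *)
Definition inv_point : closed_point X := Point io0 ioM ioD io_const io_onto.

End InvPoint.

(* The quotient X / iota is the projective line: the field of iota-invariant
   functions is k(x) for some x. *)
Definition hyperelliptic (iota : involution) :=
  (exists f, iota f != f) /\
  (exists x, forall f, iota f = f <-> ratfun (const X) x f).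

Definition weierstrass (iota : involution) : set (closed_point X) :=
  [set w | inv_point iota w = w].

(* (iota^* E)_p is spanned by the pull-backs v o iota of v in E_(iota p). *)
Definition pullback n (iota : involution) (E : sheaf n) : sheaf n :=
  fun p => [set map_mx iota v | v in E (inv_point iota p)].

(* ** Fibres *)

(* The class of v in the fibre E_p / m_p E_p of E at p, as a coset. *)
Definition fibre_class n (E : sheaf n) p (v : 'cV[X]_n) : set 'cV[X]_n :=
  [set u | exists f w, [/\ maximal_ideal p f, E p w & u = v + f *: w]].

(* The image of the fibre of a subsheaf L of E in the fibre of E at p. *)
Definition subfibre n (E L : sheaf n) p : set (set 'cV[X]_n) :=
  [set fibre_class E p v | v in L p].

(* For an isomorphism h : E -> iota^* E with matrix H and w fixed by iota, the
   fibres of E and of iota^* E at w are identified by [v] <-> [v o iota].  So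
   h acts on the fibre of E at w by [v] |-> [(H v) o iota]. *)
Definition fibre_act n (iota : involution) (H : 'M[X]_n) (v : 'cV[X]_n) :=
  map_mx iota (H *m v).

Definition eigenspace_at n (iota : involution) (E : sheaf n) (H : 'M[X]_n)
    (eps : k) (w : closed_point X) : set (set 'cV[X]_n) :=
  [set fibre_class E w v | v in
     [set v | E w v /\
        fibre_class E w (fibre_act iota H v) =
        fibre_class E w (const X eps *: v)]].

Definition eigenvalue_at n (iota : involution) (E : sheaf n) (H : 'M[X]_n)
    (eps : k) (w : closed_point X) :=
  exists v, [/\ E w v, fibre_class E w v <> fibre_class E w 0
    & fibre_class E w (fibre_act iota H v) =
      fibre_class E w (const X eps *: v)].

(* iota^* h has matrix [map_mx iota H]. *)
Definition is_lift (iota : involution) (E : sheaf 2) (H : 'M[X]_2) :=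
  [/\ sheaf_iso E (pullback iota E) H,
      map_mx iota H *m H = 1%:M
    & forall w, weierstrass iota w ->
        eigenvalue_at iota E H 1 w /\ eigenvalue_at iota E H (- 1) w].

Definition invariant_under n (iota : involution) (H : 'M[X]_n) (L : sheaf n) :=
  forall p, [set H *m v | v in L p] = pullback iota L p.

(* h^0(E (x) O([w])) > 0 *)
Definition odd_gunning_plane (E : sheaf 2) (w : closed_point X) :=
  exists v, v != 0 /\ global_sections (twist E << w >>) v.

End Curve.

Arguments std_stalk {k X} n p.

(* Main.v *)
(* Let [x] be a coordinate on [X / iota], unramified at infinity, and let [D] be its
   polar divisor.  Multiplication by a regular function acts on the finite
   dimensional space of holomorphic differentials, so regular functions are
   constant; in particular every point of the line has a point of [X] above it.
   The genus then forces [y^2 = P(x)] with [P] a sextic, and [K_X ~ D].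

   The lift [h] induces an involution [sigma] of [V = H^0(E(D))], and [dim V >= 2] by
   Riemann's inequality for [E].  A nonzero eigensection of [sigma] vanishes
   nowhere: at a non-Weierstrass point this contradicts stability, at a Weierstrass
   point it puts [E] on an odd Gunning plane.  Hence evaluation at a Weierstrass
   point [w] is injective on each eigenspace of [V]; as [h] has both eigenvalues on
   the fibre at [w], each eigenspace is a line.  The two lines are spanned by [v+]
   and [v-], the subbundles are [O(-D) v+] and [O(-D) v-], and the values of [v+] and
   [v-] at [w] span the two eigenlines.  Conversely, an invariant [O(-K_X)] is
   generated by some [v] in [V] with [sigma v = u v] where [u] is regular, hence
   constant. *)

Require Import Defs.
From mathcomp Require Import all_boot all_order all_algebra.
From mathcomp Require Import boolp classical_sets functions cardinality reals complex.
From mathcomp Require Import freeg.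
From mathcomp Require Import ring lra zify.

Import Order.TTheory GRing.Theory Num.Theory.
Local Open Scope classical_set_scope.
Local Open Scope ring_scope.
Set Implicit Arguments.
Unset Strict Implicit.
Unset Printing Implicit Defensive.

(** * Valuations and local expansions *)

(** A point is only an abstract valuation: whether a point lies above a given value of [x], how many
    do, and that the residue field is [k] must all be proved. Hence values at a point form a
    relation, [has_value], and a single device, [expansion], yields uniformizer, uniqueness and
    residue field together. A value of [x] that is not a branch value is moved to infinity, so that
    all Weierstrass points are finite and [D] consists of two points exchanged by the involution;
    then [dx / y] has divisor [(m - 2) D] for [2 m] branch values, and genus two forces [m = 3].
    Riemann's inequality predicts [h^0(E(D)) >= 4 + 2 (1 - g) = 8 - 2 m], which is 2 for [m = 3]; it
    is obtained without cohomology, by counting polynomials and subtracting local conditions. The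
    involution [sigma] is semilinear over the function field but linear over [k], so proportionality
    of eigensections has to be by constants. That both signs occur on [V] comes last: a missing sign
    would make all of [V] one eigenspace, of dimension at least two, against the bound by one. *)

Definition has_value (k : fieldType) (X : curve k) (p : closed_point X) (f : X) (c : k) :=
  mpow p 1 (f - const X c).

Section Valuations.
Variables (k : fieldType) (X : curve k) (p : closed_point X).
Implicit Types (f g : X) (m n : int).
Local Notation cst := (const X).

Lemma ord_one : ord p 1 = 0.
Proof. by rewrite -(rmorph1 cst) ord_const. Qed.

Lemma ordN f : ord p (- f) = ord p f.
Proof.
have [->|f0] := eqVneq f 0; first by rewrite oppr0.
rewrite -mulN1r ord_mul ?oppr_eq0 ?oner_eq0 //.
by rewrite -(rmorph1 cst) -rmorphN ord_const add0r.
Qed.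

Lemma ordV f : ord p f^-1 = - ord p f.
Proof.
have [->|f0] := eqVneq f 0; first by rewrite invr0 ord_zero oppr0.
have := ord_mul p f0 (invr_neq0 f0); rewrite mulfV // ord_one.
lia.
Qed.

Lemma ord_divf f g : f != 0 -> g != 0 -> ord p (f / g) = ord p f - ord p g.
Proof. by move=> f0 g0; rewrite ord_mul ?invr_neq0 // ordV. Qed.

Lemma ordX f (n : nat) : f != 0 -> ord p (f ^+ n) = ord p f * n%:Z.
Proof.
move=> f0; elim: n => [|n IHn]; first by rewrite expr0 ord_one mulr0.
by rewrite exprS ord_mul ?expf_neq0 // IHn; lia.
Qed.

Lemma ordXz f m : f != 0 -> ord p (f ^ m) = ord p f * m.
Proof.
move=> f0; case: m => n; first by rewrite -exprnP ordX.
rewrite NegzE -exprnN ordV ordX //; lia.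
Qed.

Lemma mpow_ord f m : f != 0 -> mpow p m f <-> m <= ord p f.
Proof. by move=> f0; split=> [[/eqP|//]|]; [rewrite (negPf f0)|right]. Qed.

Lemma mpow_mono f m n : n <= m -> mpow p m f -> mpow p n f.
Proof. by move=> nm [->|mf]; [left|right; apply: le_trans mf]. Qed.

Lemma mpowD f g m : mpow p m f -> mpow p m g -> mpow p m (f + g).
Proof.
have [->|f0] := eqVneq f 0; first by rewrite add0r.
have [->|g0] := eqVneq g 0; first by rewrite addr0.
have [->|fg0] := eqVneq (f + g) 0; first by left.
rewrite !mpow_ord // => mf mg; apply: le_trans (ord_add p f0 g0 fg0).
by rewrite le_min mf.
Qed.

Lemma mpowN f m : mpow p m f -> mpow p m (- f).
Proof. by case=> [->|mf]; [left; rewrite oppr0|right; rewrite ordN]. Qed.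

Lemma mpowB f g m : mpow p m f -> mpow p m g -> mpow p m (f - g).
Proof. by move=> mf mg; apply: mpowD => //; apply: mpowN. Qed.

Lemma mpowM f g m n : mpow p m f -> mpow p n g -> mpow p (m + n) (f * g).
Proof.
have [->|f0] := eqVneq f 0; first by rewrite mul0r; left.
have [->|g0] := eqVneq g 0; first by rewrite mulr0; left.
rewrite !mpow_ord ?mulf_neq0 // ord_mul //; lia.
Qed.

Lemma mpow0M f g n : mpow p 0 f -> mpow p n g -> mpow p n (f * g).
Proof. by move=> mf mg; rewrite -[n]add0r; apply: mpowM. Qed.

Lemma mpowM0 f g n : mpow p n f -> mpow p 0 g -> mpow p n (f * g).
Proof. by move=> mf mg; rewrite -[n]addr0; apply: mpowM. Qed.

Lemma mpow_const c : mpow p 0 (cst c).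
Proof. by right; rewrite ord_const. Qed.

Lemma mpow_const1 c : mpow p 1 (cst c) -> c = 0.
Proof.
case=> [/eqP|]; first by rewrite fmorph_eq0 => /eqP.
by rewrite ord_const.
Qed.

Lemma mpow_sum (I : Type) (r : seq I) (P : pred I) (F : I -> X) m :
  (forall i, P i -> mpow p m (F i)) -> mpow p m (\sum_(i <- r | P i) F i).
Proof.
move=> mF; apply: (big_ind (mpow p m)) => //; first by left.
by move=> *; apply: mpowD.
Qed.

Lemma mpow_self f : mpow p (ord p f) f.
Proof. by right. Qed.

Lemma ord_unit f c : c != 0 -> has_value p f c -> f != 0 /\ ord p f = 0.
Proof.
rewrite /has_value => c0 mf; have c0' : cst c != 0 by rewrite fmorph_eq0.
have [f0|f0] := eqVneq f 0.
  move: mf; rewrite f0 sub0r => /mpowN; rewrite opprK => /mpow_const1 /eqP.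
  by rewrite (negPf c0).
split=> //; have m0f : mpow p 0 f.
  by rewrite -(subrK (cst c) f); apply: mpowD (mpow_const c); apply: mpow_mono mf.
move: m0f; rewrite mpow_ord // le_eqVlt => /orP[/eqP //|fp].
have : mpow p 1 (f - (f - cst c)) by apply: mpowB mf; right.
rewrite opprB addrC subrK => /mpow_const1 /eqP; by rewrite (negPf c0).
Qed.

Lemma value_add f g c d : has_value p f c -> has_value p g d ->
  has_value p (f + g) (c + d).
Proof.
rewrite /has_value.
move=> mf mg; have -> : f + g - cst (c + d) = (f - cst c) + (g - cst d).
  by rewrite rmorphD opprD addrACA.
exact: mpowD.
Qed.

Lemma value_mul f g c d : has_value p f c -> has_value p g d ->
  has_value p (f * g) (c * d).
Proof.
rewrite /has_value.
move=> mf mg; have -> : f * g - cst (c * d) =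
    (f - cst c) * (g - cst d) + (cst c * (g - cst d) + cst d * (f - cst c)).
  by rewrite rmorphM; ring.
apply: mpowD; last by apply: mpowD; apply: mpow0M => //; apply: mpow_const.
by apply: (@mpow_mono _ (1 + 1)) => //; apply: mpowM.
Qed.

Lemma value_inv f c : c != 0 -> has_value p f c -> has_value p f^-1 c^-1.
Proof.
rewrite /has_value.
move=> c0 mf; have [f0 fp] := ord_unit c0 mf.
have c0' : cst c != 0 by rewrite fmorph_eq0.
have -> : f^-1 - cst c^-1 = f^-1 * (- (cst c)^-1 * (f - cst c)).
  by rewrite fmorphV; field; rewrite f0 c0'.
apply: mpow0M; first by right; rewrite ordV fp.
apply: mpow0M => //; rewrite -fmorphV -rmorphN; exact: mpow_const.
Qed.

Lemma value_const c : has_value p (cst c) c.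
Proof. by rewrite /has_value subrr; left. Qed.

Lemma value_zero f : mpow p 1 f <-> has_value p f 0.
Proof. by rewrite /has_value rmorph0 subr0. Qed.

Lemma valueXz f c (j : int) : c != 0 -> has_value p f c -> has_value p (f ^ j) (c ^ j).
Proof.
move=> c0 fc; have fcn (n : nat) : has_value p (f ^+ n) (c ^+ n).
  elim: n => [|n IHn]; last by rewrite !exprS; apply: value_mul.
  by rewrite !expr0 -(rmorph1 cst); apply: value_const.
case: j => n; first by rewrite -!exprnP.
by rewrite NegzE -!exprnN; apply: value_inv => //; rewrite expf_neq0.
Qed.

Lemma value_poly (P : {poly k}) f a : has_value p f a ->
  has_value p (map_poly cst P).[f] P.[a].
Proof.
move=> fa; elim/poly_ind: P => [|P c IHP].
  by rewrite rmorph0 !horner0 -(rmorph0 cst); apply: value_const.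
rewrite rmorphD rmorphM /= map_polyX map_polyC !hornerE.
by apply: value_add (value_const c); apply: value_mul.
Qed.

End Valuations.

(* All the local structure of the curve will be read off from the existence of
   such expansions, where [S] turns out to be a single point with uniformizer [z]. *)
Definition expansion (k : fieldType) (X : curve k) (S : set (closed_point X)) (z : X) :=
  forall f, f != 0 -> exists (m : int) u c,
    [/\ c != 0, f = z ^ m * u & forall p, S p -> has_value p u c].

Lemma closed_point_eq (k : fieldType) (X : curve k) (p q : closed_point X) :
  (forall f, f != 0 -> ord p f = ord q f) -> p = q.
Proof.
case: p => o1 z1 m1 a1 c1 s1; case: q => o2 z2 m2 a2 c2 s2 /= o12.
have o : o1 = o2.
  by apply/funext => f; have [->|/o12//] := eqVneq f 0; rewrite z1 z2.
by case: _ / o in z2 m2 a2 c2 s2 *; congr Point; apply: Prop_irrelevance.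
Qed.

Section Expansion.
Variables (k : fieldType) (X : curve k) (S : set (closed_point X)) (z : X).
Hypotheses (zS : expansion S z) (z0 : z != 0) (z1 : forall p, S p -> mpow p 1 z).

(** Write an element [t] of order 1 as [z ^ m * u] with [u] a unit: then [1 = ord z * m] with
    [ord z] at least 1, which leaves only 1. *)
Lemma expansion_uniformizer p : S p -> ord p z = 1.
Proof.
move=> Sp; have [t pt] := ord_onto p.
have t0 : t != 0 by apply/eqP => t0; move: pt; rewrite t0 ord_zero.
have [m [u [c [c0 tE /(_ _ Sp) uc]]]] := zS t0.
have [u0 pu] := ord_unit c0 uc.
have : ord p t = ord p z * m by rewrite tE ord_mul ?expfz_neq0 // pu addr0 ordXz.
move/mpow_ord: (z1 Sp) => /(_ z0); rewrite pt.
move: (ord p z) => e e1 em; have m1 : 1 <= m by nia.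
nia.
Qed.

(** The order of [f] at any point of [S] is the exponent [m], which does not depend on the point; so
    two points of [S] are the same valuation. *)
Lemma expansion_unique p q : S p -> S q -> p = q.
Proof.
move=> Sp Sq; apply: closed_point_eq => f /zS[m [u [c [c0 fE uS]]]].
have [u0 pu] := ord_unit c0 (uS _ Sp); have [_ qu] := ord_unit c0 (uS _ Sq).
by rewrite fE !ord_mul ?expfz_neq0 // !ordXz // !expansion_uniformizer // pu qu.
Qed.

Lemma expansion_residue p f : S p -> mpow p 0 f -> exists c, has_value p f c.
Proof.
move=> Sp; have [->|f0] := eqVneq f 0.
  by exists 0; rewrite -(rmorph0 (const X)); apply: value_const.
rewrite mpow_ord // => fp; have [m [u [c [c0 fE /(_ _ Sp) uc]]]] := zS f0.
have [u0 pu] := ord_unit c0 uc.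
have fm : ord p f = m.
  by rewrite fE ord_mul ?expfz_neq0 // pu addr0 ordXz // expansion_uniformizer // mul1r.
have [m0|m0] := eqVneq m 0; first by exists c; rewrite fE m0 expr0z mul1r.
by exists 0; apply: (proj1 (value_zero _ _)); right; rewrite fm; move: fp; rewrite fm; lia.
Qed.

End Expansion.

(** * Algebraic elements and regular functions are constant *)

Section ConstantField.
Variables (k : closedFieldType) (X : curve k).
Local Notation cst := (const X).

(** [P] splits into linear factors over the algebraically closed [k], and one of them vanishes at
    [u]. *)
Lemma algebraic_const (P : {poly k}) (u : X) :
  P != 0 -> (map_poly cst P).[u] = 0 -> exists c, u = cst c.
Proof.
move=> P0; have [r Pr] := closed_field_poly_normal P.
rewrite Pr linearZ /= hornerZ rmorph_prod horner_prod => /eqP.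
rewrite mulf_eq0 fmorph_eq0 lead_coef_eq0 (negPf P0) /= prodf_seq_eq0.
case/hasP => c _ /=; rewrite rmorphB /= map_polyX map_polyC hornerD hornerN hornerX hornerC.
by rewrite subr_eq0 => /eqP ->; exists c.
Qed.

Lemma has_dim_dependent n (V : set 'cV[X]_n) d (v : 'I_d.+1 -> 'cV[X]_n) :
  has_dim V d -> (forall i, V (v i)) ->
  exists a : 'I_d.+1 -> k, (exists i, a i != 0) /\ \sum_i cst (a i) *: v i = 0.
Proof.
move=> [b [_ VE]] Vv.
have /choice [A vA] : forall i, exists a : 'I_d -> k, v i = \sum_j cst (a j) *: b j.
  by move=> i; move: (Vv i); rewrite VE.
pose M : 'M[k]_(d.+1, d) := \matrix_(i, j) A i j.
have : kermx M != 0.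
  by rewrite kermx_eq0 /row_free ltn_eqF // ltnS rank_leq_col.
case/matrix0Pn => i [j Mij].
exists (fun l => kermx M i l); split; first by exists j.
under eq_bigr => l _ do rewrite vA scaler_sumr.
rewrite exchange_big big1 //= => l _.
under eq_bigr => l' _ do rewrite scalerA -rmorphM.
rewrite -scaler_suml -rmorph_sum.
have := congr1 (fun B : 'M[k]_(d.+1, d) => B i l) (mulmx_ker M); rewrite !mxE => E.
rewrite (_ : \sum_l' _ = 0) ?rmorph0 ?scale0r // -[RHS]E.
by apply: eq_bigr => l' _; rewrite [M _ _]mxE.
Qed.

End ConstantField.

Section RegularFunctions.
Variables (k : closedFieldType) (X : curve k).
Local Notation cst := (const X).

(* Multiplication by a regular function acts on a finite dimensional space of
   sections, so the function is algebraic over the constants. *)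
Lemma regular_const (D : divisor X) d (f : X) :
  has_dim (global_sections (line_bundle D)) d.+1 ->
  (forall p, mpow p 0 f) -> exists c, f = cst c.
Proof.
move=> VD fr; have [b [bfree VE]] := VD.
have Vb : global_sections (line_bundle D) (b ord0).
  rewrite VE; exists (fun j => (j == ord0)%:R).
  rewrite (bigD1 ord0) //= rmorph1 scale1r big1 ?addr0 // => j /negPf ->.
  by rewrite rmorph0 scale0r.
have b0 : b ord0 0 0 != 0.
  apply/eqP => b0; suff /bfree /(_ ord0) /eqP : \sum_(i < d.+1) cst (i == ord0)%:R *: b i = 0.
    by rewrite eqxx oner_eq0.
  rewrite (bigD1 ord0) //= rmorph1 scale1r big1.
    by rewrite addr0; apply/matrixP => i j; rewrite !ord1 b0 mxE.
  by move=> j /negPf ->; rewrite rmorph0 scale0r.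
have frn n : forall p, mpow p 0 (f ^+ n).
  move=> p; elim: n => [|n IHn]; last by rewrite exprS; apply: mpow0M.
  by rewrite expr0 -(rmorph1 cst); apply: mpow_const.
have [i|a [[i ai] aE]] := has_dim_dependent (v := fun i => f ^+ i *: b ord0) VD.
  move=> p; rewrite /line_bundle /= mxE; apply: mpow0M => //; exact: Vb.
apply: (@algebraic_const _ _ (\poly_(j < d.+2) a (inord j))).
  apply/eqP => /(congr1 (fun Q : {poly k} => Q`_i)); rewrite coef_poly coef0 ltn_ord inord_val.
  by move/eqP: ai.
rewrite poly_def rmorph_sum horner_sum; apply: (mulIf b0); rewrite mul0r mulr_suml.
have := congr1 (fun M : 'cV[X]_1 => M 0 0) aE; rewrite summxE mxE => E; rewrite -[RHS]E.
by apply: eq_bigr => j _; rewrite /= map_polyZ map_polyXn hornerZ hornerXn !mxE inord_val mulrA.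
Qed.

End RegularFunctions.

(** * Hyperelliptic models *)

Section RationalFunctions.
Variables (k K : fieldType) (c : {rmorphism k -> K}).
Implicit Types (x f g : K) (P Q : {poly k}).
Local Notation ev x P := (map_poly c P).[x].

Lemma ratfun_poly x P : ratfun c x (ev x P).
Proof.
by exists P, 1; rewrite rmorph1 hornerC oner_eq0 divr1.
Qed.

Lemma ratfun_const x a : ratfun c x (c a).
Proof. by have := ratfun_poly x a%:P; rewrite map_polyC hornerC. Qed.

Lemma ratfun_var x : ratfun c x x.
Proof. by have := ratfun_poly x 'X; rewrite map_polyX hornerX. Qed.

Lemma ratfun_add x f g : ratfun c x f -> ratfun c x g -> ratfun c x (f + g).
Proof.
move=> [P [Q [Q0 ->]]] [P' [Q' [Q0' ->]]].
exists (P * Q' + P' * Q), (Q * Q'); rewrite !rmorphD !rmorphM /= !hornerE mulf_neq0 //.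
by split=> //; field; rewrite Q0 Q0'.
Qed.

Lemma ratfun_mul x f g : ratfun c x f -> ratfun c x g -> ratfun c x (f * g).
Proof.
move=> [P [Q [Q0 ->]]] [P' [Q' [Q0' ->]]].
exists (P * P'), (Q * Q'); rewrite !rmorphM /= !hornerM mulf_neq0 //.
by rewrite mulf_div.
Qed.

Lemma ratfun_inv x f : ratfun c x f -> ratfun c x f^-1.
Proof.
move=> [P [Q [Q0 ->]]]; have [P0|P0] := eqVneq (ev x P) 0.
  by rewrite P0 mul0r invr0 -(rmorph0 c); apply: ratfun_const.
by exists Q, P; rewrite P0 invf_div.
Qed.

Lemma ratfun_trans x x' f : ratfun c x' x -> ratfun c x f -> ratfun c x' f.
Proof.
move=> xx'; have ev' P : ratfun c x' (ev x P).
  elim/poly_ind: P => [|P a IHP].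
    by rewrite rmorph0 horner0 -(rmorph0 c); apply: ratfun_const.
  rewrite rmorphD rmorphM /= map_polyX map_polyC !hornerE.
  by apply: ratfun_add (ratfun_const _ _); apply: ratfun_mul.
by move=> [P [Q [_ ->]]]; apply: ratfun_mul => //; apply: ratfun_inv.
Qed.

End RationalFunctions.

Section LocalExpansionOnLine.
Variables (k : fieldType) (X : curve k).
Implicit Types (x f g : X) (P Q : {poly k}).
Local Notation cst := (const X).
Local Notation ev x P := (map_poly cst P).[x].

Lemma value_zero_mul (p : closed_point X) (z : X) (n : int) (w : X) (e : k) :
  mpow p 1 z -> 0 < n -> has_value p w e -> has_value p (z ^ n * w) 0.
Proof.
move=> z1 n0 we; apply: (proj1 (value_zero _ _)).
rewrite -(addr0 1); apply: mpowM; last first.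
  by rewrite -(subrK (cst e) w); apply: mpowD (mpow_const _ _); apply: mpow_mono we.
case: n n0 => // -[//|n] _; rewrite -exprnP exprS -(addr0 1); apply: mpowM => //.
elim: n => [|n IHn]; last by rewrite exprS; apply: mpow0M => //; apply: mpow_mono z1.
by rewrite expr0 -(rmorph1 cst); apply: mpow_const.
Qed.

Lemma poly_local x a P : ev x P != 0 ->
  exists (n : nat) u c, [/\ c != 0, ev x P = (x - cst a) ^+ n * u &
    forall p, has_value p x a -> has_value p u c].
Proof.
move=> Px; have P0 : P != 0 by apply: contra_neq Px => ->; rewrite rmorph0 horner0.
have [n [Q]] := multiplicity_XsubC P a; rewrite P0 /= => Qa PE.
exists n, (ev x Q), Q.[a]; split=> //; last by move=> p; apply: value_poly.
by rewrite PE rmorphM rmorphXn rmorphB /= map_polyX map_polyC hornerM horner_exp hornerXsubC mulrC.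
Qed.

Lemma ratfun_local x a f : x - cst a != 0 -> ratfun cst x f -> f != 0 ->
  exists (m : int) u c, [/\ c != 0, f = (x - cst a) ^ m * u &
    forall p, has_value p x a -> has_value p u c].
Proof.
move=> xa [P [Q [Q0 ->]]] f0.
have P0 : ev x P != 0 by apply: contra_neq f0 => ->; rewrite mul0r.
have [n [u [c [c0 -> uc]]]] := poly_local a P0.
have [n' [u' [c' [c0' QE uc']]]] := poly_local a Q0.
exists (n%:Z - n'%:Z), (u / u'), (c / c'); split.
- by rewrite mulf_neq0 ?invr_neq0.
- by rewrite QE expfzDr // -invr_expz -!exprnP invfM mulrACA.
- by move=> p xp; apply: value_mul; [apply: uc|apply: value_inv => //; apply: uc'].
Qed.

End LocalExpansionOnLine.

Section HyperellipticModel.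
Variables (k : numClosedFieldType) (X : curve k) (iota : involution X).
Implicit Types (x y f g : X) (P Q : {poly k}) (p q : closed_point X).
Local Notation cst := (const X).
Local Notation ev x P := (map_poly cst P).[x].

(** An affine equation [y ^ 2 = P(x)] whose involution changes the sign of [y]. [P] may have
    repeated roots and odd degree; both are corrected later by changing [y] and [x]. *)
Definition hyperelliptic_model x y P :=
  [/\ forall f, iota f = f <-> ratfun cst x f, iota y = - y, y != 0 & y ^+ 2 = ev x P].

Lemma inv_point_has_value p f c : has_value (inv_point iota p) f c <-> has_value p (iota f) c.
Proof.
rewrite /has_value /mpow /= -[cst c in X in _ <-> X](inv_const iota) -rmorphB.
split=> -[H|H]; [left; rewrite H rmorph0 //|by right| left|by right].
by apply/eqP; rewrite -(fmorph_eq0 iota) H.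
Qed.

Lemma value_inv_point p f c : has_value p (iota f) c -> has_value (inv_point iota p) f c.
Proof. by move/inv_point_has_value. Qed.

Lemma value_of_inv_point p f c : has_value (inv_point iota p) f c -> has_value p (iota f) c.
Proof. by move/inv_point_has_value. Qed.

Lemma inv_pointK p : inv_point iota (inv_point iota p) = p.
Proof. by apply: closed_point_eq => f _; rewrite /= inv_involutive. Qed.

Lemma mpow_inv_point p n f : mpow (inv_point iota p) n f <-> mpow p n (iota f).
Proof.
rewrite /mpow /=; split=> -[H|H]; [left; rewrite H rmorph0 //|by right| left|by right].
by apply/eqP; rewrite -(fmorph_eq0 iota) H.
Qed.

Lemma two_neq0 : 2 != 0 :> X.
Proof. by rewrite -(rmorph_nat cst) fmorph_eq0 pnatr_eq0. Qed.

Section Model.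
Variables (x y : X) (P : {poly k}).
Hypothesis M : hyperelliptic_model x y P.

Lemma model_var : iota x = x.
Proof. by have [Mx _ _ _] := M; apply/Mx; apply: ratfun_var. Qed.

Lemma model_poly Q : iota (ev x Q) = ev x Q.
Proof. by have [Mx _ _ _] := M; apply/Mx; apply: ratfun_poly. Qed.

(** If [x] were constant, then [y ^ 2] and hence [y] would be constant, so [iota] would fix [y],
    against [iota y = - y] and [y != 0] in characteristic 0. *)
Lemma model_var_nonconst a : x != cst a.
Proof.
apply/eqP => xa; have [Mx My y0 yP] := M.
have : (y - cst (sqrtC P.[a])) * (y + cst (sqrtC P.[a])) = 0.
  by rewrite -subr_sqr yP xa horner_map -rmorphXn sqrtCK subrr.
move/eqP; rewrite mulf_eq0 subr_eq0 addr_eq0 => yc.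
have [c yE] : exists c, y = cst c.
  by case/orP: yc => /eqP ->; eexists; [|rewrite -rmorphN].
have : y + y = 0 by rewrite {1}yE -(inv_const iota) -yE My addNr.
by move/eqP; rewrite -mulr2n -mulr_natl mulf_eq0 (negPf two_neq0) (negPf y0).
Qed.

Lemma model_transcendental Q : Q != 0 -> ev x Q != 0.
Proof.
move=> Q0; apply/eqP => /(algebraic_const Q0)[c /eqP].
by rewrite (negPf (model_var_nonconst c)).
Qed.

Lemma model_sub_neq0 a : x - cst a != 0.
Proof. by rewrite subr_eq0 model_var_nonconst. Qed.

(** [A] and [B * y] are the components of [f] for the eigenvalues 1 and -1 of [iota]. *)
Lemma model_decomposition f :
  exists A B, [/\ ratfun cst x A, ratfun cst x B & f = A + B * y].
Proof.
have [Mx My y0 yP] := M; have n2 := two_neq0.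
exists ((f + iota f) / 2), ((f - iota f) / (2 * y)); split.
- by apply/Mx; rewrite rmorphM rmorphD fmorphV rmorph_nat inv_involutive addrC.
- apply/Mx; rewrite rmorphM rmorphB fmorphV rmorphM rmorph_nat inv_involutive My.
  by field; rewrite y0 n2 oppr_eq0 y0.
- by move: (iota f) => g; field; rewrite y0 n2.
Qed.

(** The smaller of the orders of [A] and [B] at [a] is factored out, which leaves values [c] and [d]
    that are not both zero. They are the same at all points above [a]. *)
Lemma model_local a A B : ratfun cst x A -> ratfun cst x B -> (A, B) != (0, 0) ->
  exists (m : int) A0 B0 c d, [/\ (c, d) != (0, 0), A = (x - cst a) ^ m * A0,
    B = (x - cst a) ^ m * B0 & forall p, has_value p x a -> has_value p A0 c /\ has_value p B0 d].
Proof.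
move=> rA rB AB; have xa := model_sub_neq0 a.
have v0 p : has_value p (0 : X) 0 by rewrite -(rmorph0 cst); apply: value_const.
have [A0|A0] := eqVneq A 0; have [B0|B0] := eqVneq B 0.
- by rewrite A0 B0 eqxx in AB.
- have [m [u [c [c0 BE uc]]]] := ratfun_local xa rB B0.
  exists m, 0, u, 0, c; rewrite mulr0; split=> //; first by rewrite xpair_eqE eqxx.
  by move=> p /uc.
- have [m [u [c [c0 AE uc]]]] := ratfun_local xa rA A0.
  exists m, u, 0, c, 0; rewrite mulr0; split=> //; first by rewrite xpair_eqE (negPf c0).
  by move=> p /uc.
have [m [u [c [c0 AE uc]]]] := ratfun_local xa rA A0.
have [n [v [d [d0 BE vd]]]] := ratfun_local xa rB B0.
have [mn|mn|mn] := ltrgtP m n.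
- exists m, u, ((x - cst a) ^ (n - m) * v), c, 0.
  split=> [||| p xp]; first by rewrite xpair_eqE (negPf c0).
  + by [].
  + by rewrite mulrA -expfzDr // subrKC.
  + split; first exact: uc.
    by apply: value_zero_mul (vd p xp); rewrite ?subr_gt0.
- exists n, ((x - cst a) ^ (m - n) * u), v, 0, d.
  split=> [||| p xp]; first by rewrite xpair_eqE (negPf d0) andbF.
  + by rewrite mulrA -expfzDr // subrKC.
  + by [].
  + split; last exact: vd.
    by apply: value_zero_mul (uc p xp); rewrite ?subr_gt0.
exists m, u, v, c, d; split=> //; first by rewrite xpair_eqE (negPf c0).
- by rewrite mn.
- by move=> p xp; split; [apply: uc|apply: vd].
Qed.


(* Up to a power of [x - a], [f = A + B y] where [A] and [B] are regular and do not
   both vanish over [a]; if [f] vanishes, then [A - B y] does not, and their product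
   is in [k(x)]. *)
Lemma model_unramified a b : P.[a] = b ^+ 2 -> b != 0 ->
  expansion [set p | has_value p x a /\ has_value p y b] (x - cst a).
Proof.
move=> Pa b0 f f0; have [Mx My y0 yP] := M; have xa := model_sub_neq0 a.
have [A [B [rA rB fE]]] := model_decomposition f.
have [|m [A0 [B0 [c [d [cd AE BE v0]]]]]] := model_local a rA rB.
  by apply: contra_neq f0 => -[A0 B0]; rewrite fE A0 B0 mul0r addr0.
have rz j : ratfun cst x ((x - cst a) ^ j).
  by apply/Mx; rewrite fmorphXz rmorphB inv_const model_var.
have r0 A' B' : A' = (x - cst a) ^ m * B' -> ratfun cst x A' -> ratfun cst x B'.
  move=> E rA'; have -> : B' = (x - cst a) ^ (- m) * A'.
    by rewrite E mulrA -expfzDr // addNr expr0z mul1r.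
  exact: ratfun_mul.
have [rA0 rB0] := (r0 _ _ AE rA, r0 _ _ BE rB).
have fE0 : f = (x - cst a) ^ m * (A0 + B0 * y) by rewrite fE AE BE mulrDr mulrA.
have [cdb|cdb] := eqVneq (c + d * b) 0; last first.
  exists m, (A0 + B0 * y), (c + d * b); split=> // p [/v0[Ac Bd] yb].
  by apply: value_add => //; apply: value_mul.
have cdb' : c + d * - b != 0.
  apply: contra_neq cd => cdb'; have c0 : c *+ 2 = 0.
    by rewrite -[RHS](addr0 0) -{1}cdb -cdb' mulrN mulr2n; ring.
  move/eqP: c0 cdb; rewrite mulrn_eq0 /= => /eqP ->; rewrite add0r => /eqP.
  by rewrite mulf_eq0 (negPf b0) orbF => /eqP ->.
have gE : iota (A0 + B0 * y) = A0 - B0 * y.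
  rewrite rmorphD rmorphM My (proj2 (Mx _) rA0) (proj2 (Mx _) rB0).
  by rewrite mulrN.
have h0 : A0 + B0 * y != 0 by apply: contra_neq f0; rewrite fE0 => ->; rewrite mulr0.
have g0 : A0 - B0 * y != 0 by rewrite -gE fmorph_eq0.
have rN : ratfun cst x ((A0 + B0 * y) * (A0 - B0 * y)).
  by apply/Mx; rewrite rmorphM gE -[X in _ * iota X = _]gE inv_involutive mulrC.
have [j [u [e [e0 NE ue]]]] := ratfun_local xa rN (mulf_neq0 h0 g0).
exists (m + j), (u / (A0 - B0 * y)), (e / (c + d * - b)); split.
- by rewrite mulf_neq0 ?invr_neq0.
- rewrite fE0 expfzDr // -!mulrA; congr (_ * _); apply: (mulIf g0).
  by rewrite NE -!mulrA mulVf // mulr1.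
move=> p [xp yb]; have [Ac Bd] := v0 p xp.
apply: value_mul; [exact: ue|apply: value_inv => //].
rewrite -mulrN; apply: value_add => //; apply: value_mul => //.
by rewrite /has_value rmorphN -opprD; apply: mpowN.
Qed.

Lemma model_ramified_vanish Q a p : P = ('X - a%:P) * Q -> Q.[a] != 0 ->
  has_value p x a -> mpow p 1 y /\ ord p (x - cst a) = ord p y * 2.
Proof.
move=> PE Qa xp; have [Mx My y0 yP] := M; have xa := model_sub_neq0 a.
have [q0 qp] := ord_unit Qa (value_poly Q xp).
have yE : y ^+ 2 = (x - cst a) * ev x Q.
  by rewrite yP PE rmorphM rmorphB /= map_polyX map_polyC hornerM hornerXsubC.
have := congr1 (ord p) yE; rewrite ordX // ord_mul // qp addr0 => oE.
move: xp; rewrite /has_value mpow_ord // -oE => oy.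
by split=> //; right; lia.
Qed.

(** Above a simple root, [x - a] is [y ^ 2] times a unit. So [A] has even and [B * y] odd order with
    respect to [y]: the two terms cannot cancel, and the one of smaller order gives the leading
    value. *)
Lemma model_ramified a Q : P = ('X - a%:P) * Q -> Q.[a] != 0 ->
  expansion [set p | has_value p x a] y.
Proof.
move=> PE Qa f f0; have [Mx My y0 yP] := M; have xa := model_sub_neq0 a.
have yE : y ^+ 2 = (x - cst a) * ev x Q.
  by rewrite yP PE rmorphM rmorphB /= map_polyX map_polyC hornerM hornerXsubC.
have q0 : ev x Q != 0.
  by apply: contra_neq y0 => q0; apply/eqP; rewrite -sqrf_eq0 yE q0 mulr0.
have zE : x - cst a = y ^ 2%:Z * (ev x Q)^-1 by rewrite -exprnP yE mulfK.
have loc A : ratfun cst x A -> A != 0 -> exists (m : int) u c, [/\ c != 0,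
    A = y ^ (2 * m) * u & forall p, has_value p x a -> has_value p u c].
  move=> rA A0; have [m [u [c [c0 AE uc]]]] := ratfun_local xa rA A0.
  exists m, ((ev x Q)^-1 ^ m * u), (Q.[a]^-1 ^ m * c); split.
  - by rewrite mulf_neq0 // expfz_neq0 // invr_neq0.
  - by rewrite AE zE expfzMl -exprz_exp mulrA.
  move=> p xp; apply: value_mul; last exact: uc.
  by apply: valueXz; rewrite ?invr_neq0 //; apply: value_inv => //; apply: value_poly.
have [A [B [rA rB fE]]] := model_decomposition f.
have [A0|A0] := eqVneq A 0; have [B0|B0] := eqVneq B 0.
- by move: f0; rewrite fE A0 B0 mul0r addr0 eqxx.
- have [m [u [c [c0 BE uc]]]] := loc B rB B0.
  exists (2 * m + 1), u, c; split=> //.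
  by rewrite fE A0 BE add0r expfzDr // expr1z mulrAC.
- have [m [u [c [c0 AE uc]]]] := loc A rA A0.
  by exists (2 * m), u, c; split=> //; rewrite fE B0 AE mul0r addr0.
have [m [u [c [c0 AE uc]]]] := loc A rA A0.
have [n [v [d [d0 BE vd]]]] := loc B rB B0.
(* The orders to compare are [2 m] and [2 n + 1], and [2 m < 2 n + 1] exactly when [m <= n]. *)
have [mn|mn] := lerP m n.
- exists (2 * m), (u + y ^ (2 * n + 1 - 2 * m) * v), c; split=> //.
    rewrite fE AE BE mulrDr; congr (_ + _).
    rewrite mulrA -expfzDr // (_ : 2 * m + _ = 2 * n + 1); last by lia.
    by rewrite expfzDr // expr1z mulrAC.
  move=> p xp; rewrite -[c]addr0; apply: value_add; first exact: uc.
  have [yp _] := model_ramified_vanish PE Qa xp.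
  by apply: value_zero_mul (vd p xp) => //; lia.
exists (2 * n + 1), (y ^ (2 * m - (2 * n + 1)) * u + v), d; split=> //.
  rewrite fE AE BE mulrDr; congr (_ + _).
    by rewrite mulrA -expfzDr // subrKC.
  by rewrite expfzDr // expr1z mulrAC.
move=> p xp; rewrite -[d]add0r; apply: value_add; last exact: vd.
have [yp _] := model_ramified_vanish PE Qa xp.
by apply: value_zero_mul (uc p xp) => //; lia.
Qed.

End Model.
End HyperellipticModel.

Lemma not_uniq_perm (T : eqType) (s : seq T) :
  ~~ uniq s -> exists a s', perm_eq s [:: a, a & s'].
Proof.
elim: s => //= b s IHs; rewrite negb_and negbK; case/orP=> [bs|/IHs[a [s' ss']]].
  by exists b, (rem b s); rewrite perm_cons perm_to_rem.
exists a, (b :: s'); rewrite -(perm_cons b) in ss'; apply: perm_trans ss' _.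
by apply/permPl/(perm_catCA [:: b] [:: a; a] s').
Qed.

(** * A squarefree model of even degree *)

Section ModelExistence.
Variables (k : numClosedFieldType) (X : curve k) (iota : involution X).
Implicit Types (x y f g : X) (P Q : {poly k}) (p q : closed_point X) (s : seq k).
Local Notation cst := (const X).
Local Notation ev x P := (map_poly cst P).[x].

Definition branch_poly s : {poly k} := \prod_(a <- s) ('X - a%:P).

Lemma branch_polyE x s : ev x (branch_poly s) = \prod_(a <- s) (x - cst a).
Proof.
rewrite rmorph_prod horner_prod; apply: eq_bigr => a _.
by rewrite rmorphB /= map_polyX map_polyC hornerXsubC.
Qed.

(** A repeated root [a] is removed by dividing [y] by [x - a], which is invariant and so keeps the
    sign rule for [y]; the leading coefficient is absorbed through its square root. *)
Lemma model_squarefree x y P : hyperelliptic_model iota x y P ->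
  exists y' s, uniq s /\ hyperelliptic_model iota x y' (branch_poly s).
Proof.
case=> Mx My y0 yP.
have P0 : P != 0.
  by apply: contra_neq y0 => P0; apply/eqP; rewrite -sqrf_eq0 yP P0 rmorph0 horner0.
have [r] := closed_field_poly_normal P; move: (lead_coef P) (P0) => c.
rewrite -lead_coef_eq0; move: (lead_coef P) => c' c0'.
rewrite -/(branch_poly r) => PE.
have [c1 c10 yE] : exists2 c1 : k, c1 != 0 & y ^+ 2 = cst c1 * \prod_(a <- r) (x - cst a).
  exists c; last by rewrite yP PE linearZ /= hornerZ branch_polyE.
  by apply: contra_neq P0 => c0; rewrite PE c0 scale0r.
move: {2}(size r) (leqnn (size r)) => n {PE yP c'  c0' P P0}.
elim: n r y My y0 yE => [|n IHn] r y My y0 yE.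
  rewrite leqn0 size_eq0 => /eqP r0; exists (y / cst (sqrtC c1)), [::]; split=> //.
  have q0 : cst (sqrtC c1) != 0 by rewrite fmorph_eq0 sqrtC_eq0.
  split=> //; first by rewrite rmorphM fmorphV inv_const My mulNr.
    by rewrite mulf_neq0 ?invr_neq0.
  by rewrite branch_polyE big_nil expr_div_n yE r0 big_nil -rmorphXn sqrtCK mulr1 divff // fmorph_eq0.
move=> rn; have [ur|/not_uniq_perm[a [r' rE]]] := boolP (uniq r).
  exists (y / cst (sqrtC c1)), r; split=> //.
  have q0 : cst (sqrtC c1) != 0 by rewrite fmorph_eq0 sqrtC_eq0.
  split=> //; first by rewrite rmorphM fmorphV inv_const My mulNr.
    by rewrite mulf_neq0 ?invr_neq0.
  by rewrite branch_polyE expr_div_n yE -rmorphXn sqrtCK mulrAC divff ?mul1r // fmorph_eq0.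
have xa : x - cst a != 0.
  move: y0; apply: contra_neq => xa; apply/eqP.
  by rewrite -sqrf_eq0 yE (perm_big _ rE) big_cons /= xa mul0r mulr0.
apply: (IHn r' (y / (x - cst a))).
- rewrite rmorphM fmorphV rmorphB inv_const My mulNr (proj2 (Mx x)) //; exact: ratfun_var.
- by rewrite mulf_neq0 ?invr_neq0.
- rewrite expr_div_n yE (perm_big _ rE) !big_cons /=; field; exact: xa.
- by move: rn; rewrite (perm_size rE) /=; lia.
Qed.

Lemma model_change_var x y P x' y' P' : hyperelliptic_model iota x y P ->
  ratfun cst x' x -> ratfun cst x x' -> iota y' = - y' -> y' != 0 -> y' ^+ 2 = ev x' P' ->
  hyperelliptic_model iota x' y' P'.
Proof.
case=> Mx _ _ _ xx' x'x My' y0' yE'; split=> // f; split=> [/Mx|] fr.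
  exact: ratfun_trans fr.
by apply/Mx; apply: ratfun_trans fr.
Qed.

(** The witness is one more than the sum of the moduli of [s], hence of larger modulus than each
    element. *)
Lemma exists_notin s : exists b, b \notin s.
Proof.
exists (1 + \sum_(a <- s) `|a|); apply/negP => bs.
have : \sum_(a <- s) `|a| = \sum_(a <- _ :: rem _ s) `|a| := perm_big _ (perm_to_rem bs).
rewrite big_cons; set b := 1 + _; move: (\sum_(a <- s) _) @b => S b.
have S' : 0 <= \sum_(j <- rem b s) `|j| by rewrite sumr_ge0.
move=> SE; have S0 : 0 <= S by rewrite SE addr_ge0.
move: SE; rewrite ger0_norm ?addr_ge0 //; move: S' => /=.
move: (\sum_(j <- _) _) => T T0 SE.
have E : 1 + T = 0 by apply: (addrI S); rewrite addr0 [RHS]SE /b; ring.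
by have := ltr_wpDr T0 (@ltr01 k); rewrite E ltxx.
Qed.

Lemma model_even : hyperelliptic iota ->
  exists x y s m, [/\ uniq s, size s = m.*2 & hyperelliptic_model iota x y (branch_poly s)].
Proof.
case=> -[f0 f0i] [x Mx].
have [U [V [V0 yE]]] : ratfun cst x ((f0 - iota f0) ^+ 2).
  by apply/Mx; rewrite rmorphXn rmorphB inv_involutive -sqrrN opprB.
(* [f0 - iota f0] is anti-invariant with square [U / V]; multiplied by [V] it has the polynomial
   square [U * V]. *)
have M0 : hyperelliptic_model iota x ((f0 - iota f0) * ev x V) (U * V).
  split=> //.
  - rewrite rmorphM rmorphB inv_involutive (proj2 (Mx (ev x V))); last exact: ratfun_poly.
    by rewrite -mulNr opprB.
  - by rewrite mulf_neq0 // subr_eq0 eq_sym.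
  - by rewrite exprMn yE rmorphM hornerM; field.
have [y [s [us M]]] := model_squarefree M0; have [_ My y0 yP] := M.
have [so|se] := boolP (odd (size s)); last first.
  by exists x, y, s, (size s)./2; split=> //; rewrite even_halfK.
have [b bs] := exists_notin s.
have xb : x - cst b != 0 := model_sub_neq0 M b.
(* With an odd number of branch values, infinity is itself a branch value. This change of coordinate
   sends it to 0, and sends the non-branch value [b] to infinity. *)
set x' := (x - cst b)^-1; have x0' : x' != 0 by rewrite invr_neq0.
have xE : x = cst b + x'^-1 by rewrite invrK subrKC.
have ix' : iota x' = x' by rewrite fmorphV rmorphB inv_const (model_var M).
clearbody x'; pose r a := (a - b)^-1.
(* Factor by factor, [(x - a) x' = (b - a) (x' - r a)]. *)
have prodE s' : b \notin s' -> \prod_(a <- s') (x - cst a) * x' ^+ size s' =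
    cst (\prod_(a <- s') (b - a)) * \prod_(a <- map r s') (x' - cst a).
  elim: s' => [|a s' IHs']; first by rewrite !big_nil rmorph1.
  rewrite in_cons negb_or => /andP[ab /IHs' {}IHs'] /=.
  rewrite !big_cons rmorphM exprS mulrACA IHs'.
  have ab0 : cst a - cst b != 0 by rewrite -rmorphB fmorph_eq0 subr_eq0 eq_sym.
  rewrite [RHS]mulrACA; congr (_ * _); rewrite /r fmorphV !rmorphB xE.
  by field; rewrite ab0 x0'.
pose C := \prod_(a <- s) (b - a).
have C0 : C != 0.
  rewrite prodf_seq_neq0; apply/allP => d ds /=.
  by rewrite subr_eq0; apply: contraNneq bs => ->.
have q0 : cst (sqrtC C) != 0 by rewrite fmorph_eq0 sqrtC_eq0.
(* The new branch value 0 is the old infinity. It makes the number of branch values even, and the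
   power of [x'] clears the denominators of [y ^ 2]. *)
exists x', (y * x' ^+ (size s).+1./2 / cst (sqrtC C)), (0 :: map r s), (size s).+1./2.
have se : (size s).+1./2.*2 = (size s).+1 by rewrite even_halfK //= so.
split.
- rewrite /= map_inj_uniq ?us ?andbT; last by move=> a a' /invr_inj /addIr.
  by apply/mapP => -[a as_ /esym/eqP]; rewrite invr_eq0 subr_eq0 => /eqP ab; rewrite -ab as_ in bs.
- by rewrite /= size_map se.
apply: (model_change_var M).
- by rewrite xE; apply: ratfun_add; [exact: ratfun_const|apply: ratfun_inv; exact: ratfun_var].
- by apply/Mx; rewrite ix'.
- by rewrite !rmorphM rmorphXn ix' fmorphV inv_const My !mulNr.
- by rewrite !mulf_neq0 ?invr_neq0 ?expf_neq0.
rewrite branch_polyE big_cons rmorph0 subr0 !exprMn -exprM muln2 se.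
have q2 : cst (sqrtC C) ^+ 2 = cst C by rewrite -rmorphXn sqrtCK.
rewrite exprVn q2 yP.
rewrite branch_polyE exprS mulrCA prodE // -/C; field; by rewrite fmorph_eq0.
Qed.

(** The chart at infinity. As the number of branch values is even, a power [x ^ m] turns [y] into a
    square root of the reversed polynomial, whose value at 0 is 1; infinity is therefore
    unramified. *)
Lemma model_inv x y s m : size s = m.*2 -> hyperelliptic_model iota x y (branch_poly s) ->
  hyperelliptic_model iota x^-1 (y / x ^+ m) (\prod_(a <- s) (1 - a *: 'X)).
Proof.
move=> sm M; have [Mx My y0 yE] := M.
have x0 : x != 0 by rewrite -(rmorph0 cst); apply: (model_var_nonconst M).
apply: (model_change_var M).
- by rewrite -{2}[x]invrK; apply: ratfun_inv; exact: ratfun_var.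
- by apply: ratfun_inv; exact: ratfun_var.
- by rewrite rmorphM fmorphV rmorphXn (model_var M) My mulNr.
- by rewrite mulf_neq0 ?invr_neq0 ?expf_neq0.
rewrite rmorph_prod horner_prod expr_div_n yE branch_polyE -exprM muln2 -sm.
elim: s {sm yE M} => [|a s IHs]; first by rewrite !big_nil divr1.
rewrite !big_cons /= exprS -IHs rmorphB rmorph1 /= map_polyZ map_polyX !hornerE /=.
by field; rewrite x0 expf_neq0.
Qed.

End ModelExistence.

(** * Points above each value of the coordinate *)

Section Fibres.
Variables (k : numClosedFieldType) (X : curve k) (iota : involution X).
Implicit Types (x y f g : X) (P Q : {poly k}) (p q : closed_point X) (s : seq k).
Local Notation cst := (const X).
Local Notation ev x P := (map_poly cst P).[x].

Lemma has_value_inj p f c d : has_value p f c -> has_value p f d -> c = d.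
Proof.
move=> fc fd; apply/eqP; rewrite -subr_eq0; apply/eqP; apply: (@mpow_const1 _ _ p).
rewrite rmorphB (_ : _ - _ = (f - cst d) - (f - cst c)); last by ring.
exact: mpowB.
Qed.

Lemma mpow1_factor p f g : mpow p 0 f -> mpow p 0 g -> mpow p 1 (f * g) ->
  mpow p 1 f \/ mpow p 1 g.
Proof.
have [->|f0] := eqVneq f 0; first by left; left.
have [->|g0] := eqVneq g 0; first by right; left.
rewrite !mpow_ord ?mulf_neq0 // ord_mul // => f1 g1 fg.
by have : 1 <= ord p f \/ 1 <= ord p g by lia.
Qed.

Section Model.
Variables (x y : X) (P : {poly k}).
Hypothesis M : hyperelliptic_model iota x y P.

Lemma ramified_fibre a p : root P a -> ~~ root P^`() a -> has_value p x a ->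
  [/\ ord p (x - cst a) = 2, ord p y = 1, inv_point iota p = p,
      forall q, has_value q x a -> q = p
    & forall f, mpow p 0 f -> exists c, has_value p f c].
Proof.
move=> /factor_theorem[Q PE]; rewrite mulrC in PE.
rewrite PE derivM derivXsubC mul1r /root !hornerE subrr mul0r addr0 => Qa xp.
have [_ _ y0 _] := M.
have xS := model_ramified M PE Qa.
have S1 q : has_value q x a -> mpow q 1 y by case/(model_ramified_vanish M PE Qa).
have py := expansion_uniformizer xS y0 S1 xp.
have [_ pxa] := model_ramified_vanish M PE Qa xp.
split=> //; first by rewrite pxa py.
- apply: (expansion_unique xS y0 S1) => //.
  by apply: value_inv_point; rewrite (model_var M).
- by move=> q xq; apply: (expansion_unique xS y0 S1 xq).
- by move=> f; exact: (expansion_residue xS y0 S1 xp).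
Qed.

Lemma model_value a b p : P.[a] = b ^+ 2 -> b != 0 -> has_value p x a ->
  ord p y = 0 /\ (has_value p y b \/ has_value p y (- b)).
Proof.
move=> Pa b0 xp; have [_ _ y0 yE] := M.
have P0 : P.[a] != 0 by rewrite Pa expf_neq0.
have [_ oP] := ord_unit P0 (value_poly P xp).
have oy : ord p y = 0 by have := congr1 (ord p) yE; rewrite oP ordX //; lia.
split=> //; rewrite /has_value rmorphN opprK; apply: mpow1_factor.
- by apply: mpowB; [right; rewrite oy|exact: mpow_const].
- by apply: mpowD; [right; rewrite oy|exact: mpow_const].
by rewrite -subr_sqr yE -rmorphXn -Pa; apply: value_poly.
Qed.

(** Let [b] be the square root of [P.[a]] that is the value of [y] at [p]. Only one point has the
    values [a] and [b], and a point above [a] where [y] has value [- b] is carried to it by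
    [iota]. *)
Lemma unramified_fibre a p : ~~ root P a -> has_value p x a ->
  [/\ ord p (x - cst a) = 1, ord p y = 0, inv_point iota p <> p,
      forall q, has_value q x a -> q = p \/ q = inv_point iota p
    & forall f, mpow p 0 f -> exists c, has_value p f c].
Proof.
move=> Pa xp; have [_ My _ _] := M.
have [b b0 [bE yb]] : exists2 b, b != 0 & P.[a] = b ^+ 2 /\ has_value p y b.
  have r0 : sqrtC P.[a] != 0 by rewrite sqrtC_eq0.
  have [_ [yb|yb]] := model_value (esym (sqrtCK _)) r0 xp.
    by exists (sqrtC P.[a]); rewrite ?sqrtCK.
  by exists (- sqrtC P.[a]); rewrite ?oppr_eq0 ?sqrrN ?sqrtCK.
have [py _] := model_value bE b0 xp.
have xS := model_unramified M bE b0.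
have xa0 := model_sub_neq0 M a.
have S1 q : has_value q x a /\ has_value q y b -> mpow q 1 (x - cst a) by case.
have Sp : has_value p x a /\ has_value p y b by [].
have neg q : has_value q y (- b) -> has_value (inv_point iota q) y b.
  move=> yq; apply: value_inv_point; rewrite My /has_value -[b]opprK rmorphN -opprD.
  exact: mpowN.
split=> //.
- exact: (expansion_uniformizer xS xa0 S1 Sp).
- move=> pE; have : has_value p (iota y) b by apply: value_of_inv_point; rewrite pE.
  rewrite My => yb'; have := value_add yb yb'; rewrite subrr -(rmorph0 cst).
  move/(has_value_inj (value_const p 0))/eqP; rewrite eq_sym -mulr2n mulrn_eq0 /=.
  by rewrite (negPf b0).
- move=> q xq; have [_ [yq|yq]] := model_value bE b0 xq.
    by left; apply: (expansion_unique xS xa0 S1).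
  right; rewrite -[q](inv_pointK iota); congr (inv_point iota _).
  apply: (expansion_unique xS xa0 S1) => //; split; last exact: neg.
  by apply: value_inv_point; rewrite (model_var M).
- by move=> f; exact: (expansion_residue xS xa0 S1 Sp).
Qed.

(* Otherwise all of [k(x)^*] consists of units at [p], and so does [K^*], since
   every [t] satisfies [t^2 = T t - N] with [T] and [N] in [k(x)]. *)
Lemma model_finite_value p : mpow p 0 x -> exists a, has_value p x a.
Proof.
move=> x_reg; apply: contrapT => noval.
have [Mx My y0 yE] := M.
have xa a : ord p (x - cst a) = 0.
  have xa0 := model_sub_neq0 M a.
  have : mpow p 0 (x - cst a) by apply: mpowB => //; exact: mpow_const.
  rewrite mpow_ord // le_eqVlt => /orP[/eqP //|xa].
  by case: noval; exists a; right; lia.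
have oP Q : Q != 0 -> ord p (ev x Q) = 0.
  move=> Q0; have [r ->] := closed_field_poly_normal Q.
  rewrite linearZ /= hornerZ -/(branch_poly r) branch_polyE.
  have lc0 : cst (lead_coef Q) != 0 by rewrite fmorph_eq0 lead_coef_eq0.
  elim: r => [|a r IHr]; first by rewrite big_nil mulr1 ord_const.
  rewrite big_cons mulrCA ord_mul ?(model_sub_neq0 M) ?xa ?add0r //.
  by rewrite mulf_neq0 // prodf_seq_neq0; apply/allP => b _; rewrite /= (model_sub_neq0 M).
have rreg f : ratfun cst x f -> f != 0 -> ord p f = 0.
  move=> [U [V [V0 ->]]] f0.
  have U0 : ev x U != 0 by apply: contra_neq f0 => ->; rewrite mul0r.
  rewrite ord_divf // !oP ?subrr //.
    by apply: contra_neq V0 => ->; rewrite rmorph0 horner0.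
  by apply: contra_neq U0 => ->; rewrite rmorph0 horner0.
have [t pt] := ord_onto p.
have t0 : t != 0 by apply/eqP => t0; move: pt; rewrite t0 ord_zero.
have it0 : iota t != 0 by rewrite fmorph_eq0.
have rT : ratfun cst x (t + iota t) by apply/Mx; rewrite rmorphD inv_involutive addrC.
have rN : ratfun cst x (t * iota t) by apply/Mx; rewrite rmorphM inv_involutive mulrC.
have : mpow p 1 (t * iota t).
  have -> : t * iota t = t * ((t + iota t) - t) by rewrite [t + _]addrC addrK.
  apply: mpowM0; first by right; rewrite pt.
  apply: mpowB; last by right; rewrite pt.
  by have [->|/(rreg _ rT) T0] := eqVneq (t + iota t) 0; [left|right; rewrite T0].
by rewrite mpow_ord ?mulf_neq0 // rreg // mulf_neq0.
Qed.

End Model.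

Section BranchModel.
Variables (x y : X) (s : seq k) (m : nat).
Hypotheses (s_size : size s = m.*2) (M : hyperelliptic_model iota x y (branch_poly s)).

Lemma model_neq0 : x != 0.
Proof. by have := model_sub_neq0 M 0; rewrite rmorph0 subr0. Qed.

Lemma branch_nonroot a : a \notin s -> ~~ root (branch_poly s) a.
Proof. by rewrite root_prod_XsubC. Qed.

Lemma finite_nonbranch a p : a \notin s -> has_value p x a ->
  [/\ ord p (x - cst a) = 1, ord p y = 0, inv_point iota p <> p
    & forall q, has_value q x a -> q = p \/ q = inv_point iota p].
Proof. by move=> /branch_nonroot ra xp; have [] := unramified_fibre M ra xp. Qed.

Lemma infinity_value p : ord p x < 0 <-> has_value p x^-1 0.
Proof.
rewrite /has_value rmorph0 subr0 mpow_ord ?invr_eq0 ?model_neq0 // ordV; split; lia.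
Qed.

Lemma model_infinity p : ord p x < 0 ->
  [/\ ord p x = -1, ord p y = - m%:Z, inv_point iota p <> p,
      forall q, ord q x < 0 -> q = p \/ q = inv_point iota p
    & forall f, mpow p 0 f -> exists c, has_value p f c].
Proof.
move=> px; have M' := model_inv s_size M; have x0 := model_neq0.
have r0 : ~~ root (\prod_(a <- s) (1 - a *: 'X)) 0.
  rewrite /root horner_prod prodf_seq_eq0; apply/hasPn => a _.
  by rewrite /= !hornerE ?mulr0 subr0 oner_eq0.
have [] := unramified_fibre M' r0 (proj1 (infinity_value p) px).
rewrite rmorph0 subr0 ordV => ox oy ip fq res; split=> //; first by lia.
  move: oy; rewrite ord_mul ?invr_neq0 ?expf_neq0 //; last by case: M.
  rewrite ordV ordX //; lia.
by move=> q qx; apply: fq; apply/infinity_value.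
Qed.

Lemma point_cases p : (exists a, has_value p x a) \/ ord p x < 0.
Proof.
have [px|px] := ltP (ord p x) 0; [by right|left].
by apply: (model_finite_value M); right.
Qed.

Hypothesis s_uniq : uniq s.

Lemma branch_simple_root a : a \in s -> root (branch_poly s) a /\ ~~ root (branch_poly s)^`() a.
Proof.
move=> as_; rewrite root_prod_XsubC; split=> //.
rewrite /branch_poly (perm_big _ (perm_to_rem as_)) big_cons.
rewrite derivM derivXsubC mul1r /root !hornerE subrr mul0r addr0.
rewrite -/(root _ _) root_prod_XsubC.
by have := perm_uniq (perm_to_rem as_); rewrite s_uniq /= => /esym/andP[].
Qed.

Lemma finite_branch a p : a \in s -> has_value p x a ->
  [/\ ord p (x - cst a) = 2, ord p y = 1, inv_point iota p = p
    & forall q, has_value q x a -> q = p].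
Proof. by move=> /branch_simple_root[ra da] xp; have [] := ramified_fibre M ra da xp. Qed.

Lemma residue p f : mpow p 0 f -> exists c, has_value p f c.
Proof.
have [[a xp]|px] := point_cases p; last by have [_ _ _ _] := model_infinity px; apply.
have [as_|as_] := boolP (a \in s).
  by have [ra da] := branch_simple_root as_; have [_ _ _ _] := ramified_fibre M ra da xp; apply.
by have [_ _ _ _] := unramified_fibre M (branch_nonroot as_) xp; apply.
Qed.

Lemma weierstrassP p : weierstrass iota p <-> exists2 a, a \in s & has_value p x a.
Proof.
split=> [wp|[a as_ xp]]; last by have [] := finite_branch as_ xp.
have [[a xp]|px] := point_cases p; last by have [_ _ /(_ wp)] := model_infinity px.
have [as_|as_] := boolP (a \in s); first by exists a.
by have [_ _ /(_ wp)] := finite_nonbranch as_ xp.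
Qed.

End BranchModel.
End Fibres.

(** * Derivations and the canonical divisor *)

Lemma deriv_eq0_polyC (k : numFieldType) (P : {poly k}) : P^`() = 0 -> P = (P`_0)%:P.
Proof.
move=> P0; apply/polyP => -[|i]; rewrite coefC //=.
have := congr1 (fun Q : {poly k} => Q`_i) P0; rewrite coef_deriv coef0 => /eqP.
by rewrite mulrn_eq0 /= => /eqP.
Qed.

(** A fraction with zero derivative is constant. Once [U] and [V] are coprime, [V] divides
    [U * V^]()[, hence]V^[()], which has smaller degree; so [V^]() = 0[, then]U^[() = 0], and in
    characteristic 0 both are constants. *)
Lemma wronskian_eq0 (k : numFieldType) (U V : {poly k}) :
  V != 0 -> U^`() * V = U * V^`() -> exists c, U = c *: V.
Proof.
move=> V0 W; set g := gcdp U V.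
have g0 : g != 0 by rewrite gcdp_eq0 (negPf V0) andbF.
have UE : U = (U %/ g) * g by rewrite divpK // dvdp_gcdl.
have VE : V = (V %/ g) * g by rewrite divpK // dvdp_gcdr.
have cop : coprimep (U %/ g) (V %/ g) by rewrite coprimep_div_gcd // V0 orbT.
move: (U %/ g) (V %/ g) UE VE cop => U1 V1 UE VE cop.
have V10 : V1 != 0 by apply: contra_neq V0 => V10; rewrite VE V10 mul0r.
have W1 : U1^`() * V1 = U1 * V1^`().
  apply: (mulIf (mulf_neq0 g0 g0)); apply/eqP; rewrite -subr_eq0; apply/eqP.
  rewrite -[RHS](subrr (U * V^`())) -{1}W {-1}UE {-1}VE UE VE !derivM; ring.
have V1' : V1^`() = 0.
  apply/eqP; apply/negPn/negP => V1'.
  have : V1 %| U1 * V1^`() by rewrite -W1 dvdp_mulIr.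
  by rewrite Gauss_dvdpr 1?coprimep_sym // gtNdvdp // lt_size_deriv.
have U1' : U1^`() = 0 by apply: (mulIf V10); rewrite W1 V1' mulr0 mul0r.
have cV : V1`_0 != 0 by apply: contra_neq V10 => c0; rewrite (deriv_eq0_polyC V1') c0.
exists (U1`_0 / V1`_0).
rewrite UE VE (deriv_eq0_polyC U1') (deriv_eq0_polyC V1') !coefC /= !mul_polyC scalerA.
by rewrite divfK.
Qed.

Section Derivations.
Variables (k : numClosedFieldType) (X : curve k) (iota : involution X).
Implicit Types (d : X -> X) (x y f g : X) (P Q : {poly k}) (p q : closed_point X).
Local Notation cst := (const X).
Local Notation ev x P := (map_poly cst P).[x].

Lemma derivation0 d : derivation d -> d 0 = 0.
Proof. by move=> [_ _ dc]; rewrite -[X in d X](rmorph0 cst) dc. Qed.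

Lemma derivationN d f : derivation d -> d (- f) = - d f.
Proof.
move=> dd; have [dD _ _] := dd; apply/eqP.
by rewrite -addr_eq0 -dD addNr derivation0.
Qed.

Lemma derivation_sq d f : derivation d -> d (f ^+ 2) = 2 * f * d f.
Proof. by case=> _ dM _; rewrite expr2 dM; ring. Qed.

Lemma derivationV d f : derivation d -> f != 0 -> d f^-1 = - d f / f ^+ 2.
Proof.
move=> [_ dM dc] f0; have : d (f * f^-1) = 0 by rewrite mulfV // -(rmorph1 cst) dc.
rewrite dM => /eqP; rewrite addrC addr_eq0 => /eqP E.
by apply: (mulfI f0); rewrite E; field.
Qed.

Lemma derivation_poly d x P : derivation d -> d (ev x P) = ev x P^`() * d x.
Proof.
move=> dd; have [dD dM dc] := dd; elim/poly_ind: P => [|P c IHP].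
  by rewrite deriv0 rmorph0 !horner0 mul0r derivation0.
rewrite derivMXaddC !rmorphD !rmorphM /= map_polyX map_polyC !hornerE dD dM dc IHP; ring.
Qed.

Lemma derivation_comb d1 d2 a b : derivation d1 -> derivation d2 ->
  derivation (fun f => a * d1 f - b * d2 f).
Proof.
move=> [D1 M1 c1] [D2 M2 c2]; split=> [f g|f g|c].
- by rewrite D1 D2; ring.
- by rewrite M1 M2; ring.
- by rewrite c1 c2; ring.
Qed.

Section Model.
Variables (x y : X) (P : {poly k}).
Hypothesis M : hyperelliptic_model iota x y P.

(** [d] kills [k(x)], and then [2 y d y = d (P(x)) = 0] shows that it kills [y]. *)
Lemma derivation_model_eq0 d f : derivation d -> d x = 0 -> d f = 0.
Proof.
move=> dd dx; have [dD dM dc] := dd; have [_ _ y0 yE] := M.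
have dpoly Q : d (ev x Q) = 0 by rewrite (derivation_poly _ _ dd) dx mulr0.
have drat g : ratfun cst x g -> d g = 0.
  by move=> [U [V [V0 ->]]]; rewrite dM (derivationV dd) // !dpoly oppr0 !mul0r mulr0 addr0.
have dy : d y = 0.
  have := derivation_sq y dd; rewrite yE dpoly => /esym/eqP.
  by rewrite !mulf_eq0 (negPf (two_neq0 X)) (negPf y0) => /eqP.
have [A [B [rA rB ->]]] := model_decomposition M f.
by rewrite dD dM dy !drat // mul0r mulr0 !addr0.
Qed.

(** The combination of [d1] and [d2] that kills [x] is zero: derivations over [k] form a space of
    dimension at most one over the function field. *)
Lemma derivation_proportional d1 d2 f : derivation d1 -> derivation d2 ->
  d1 x * d2 f = d2 x * d1 f.
Proof.
move=> D1 D2; apply/eqP; rewrite -subr_eq0; apply/eqP.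
apply: (derivation_model_eq0 f (derivation_comb (d1 x) (d2 x) D2 D1)).
by rewrite mulrC subrr.
Qed.

(** The conjugate of [d] by [iota] also sends [x] to 1, hence equals [d], so [iota f] is killed too.
    The trace and the norm of [f] then lie in [k(x)] with zero derivative; they are constants, and
    [f] is a root of a quadratic polynomial over [k]. *)
Lemma derivation_kernel d f : derivation d -> d x = 1 -> d f = 0 -> exists c, f = cst c.
Proof.
move=> dd dx df; have [dD dM dc] := dd; have [Mx _ _ _] := M.
have rat g : ratfun cst x g -> d g = 0 -> exists c, g = cst c.
  move=> [U [V [V0 ->]]]; rewrite dM (derivationV dd) // !(derivation_poly _ _ dd) dx => E.
  have V0' : V != 0 by apply: contra_neq V0 => ->; rewrite rmorph0 horner0.
  have [|c ->] := @wronskian_eq0 _ U V V0'; last first.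
    by exists c; rewrite linearZ /= hornerZ mulfK.
  apply/eqP; rewrite -subr_eq0; apply/negPn/negP => /(model_transcendental M)/eqP; apply.
  rewrite rmorphB !rmorphM /= hornerD hornerN !hornerM.
  rewrite -[RHS](mulr0 (ev x V ^+ 2)) -E; by field.
have di : derivation (fun g => iota (d (iota g))).
  split=> [g h|g h|c].
  - by rewrite rmorphD dD rmorphD.
  - by rewrite rmorphM dM rmorphD !rmorphM !inv_involutive.
  - by rewrite inv_const dc rmorph0.
have dif : d (iota f) = 0.
  have := derivation_proportional f dd di; rewrite (model_var M) dx df rmorph1 mul1r mulr0.
  by move/eqP; rewrite fmorph_eq0 => /eqP.
have [||c Tc] := rat (f + iota f).
- by apply/Mx; rewrite rmorphD inv_involutive addrC.
- by rewrite dD df dif addr0.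
have [||e Ne] := rat (f * iota f).
- by apply/Mx; rewrite rmorphM inv_involutive mulrC.
- by rewrite dM df dif mul0r mulr0 addr0.
apply: (@algebraic_const _ _ ('X ^+ 2 - c *: 'X + e%:P)).
  apply/eqP => /(congr1 (fun Q : {poly k} => Q`_2)).
  rewrite !coefD coefN coefZ coefX coefXn coefC coef0 /= mulr0 subr0 addr0 => /eqP.
  by rewrite oner_eq0.
rewrite rmorphD rmorphB rmorphXn /= map_polyZ map_polyX map_polyC !hornerE.
have : f ^+ 2 - (f + iota f) * f + f * iota f = 0 by ring.
by rewrite Tc Ne.
Qed.

End Model.
End Derivations.

(** * Canonical divisor, genus and supports *)

Section GlobalGeometry.
Variables (k : numClosedFieldType) (X : curve k) (iota : involution X).
Implicit Types (f g : X) (P Q : {poly k}) (p q : closed_point X).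
Local Notation cst := (const X).
Local Notation ev x P := (map_poly cst P).[x].
Variables (x y : X) (s : seq k) (m : nat).
Hypotheses (s_uniq : uniq s) (s_size : size s = m.*2)
  (M : hyperelliptic_model iota x y (branch_poly s))
  (regularE : forall f, (forall p, mpow p 0 f) -> exists c, f = cst c).

(* Multiplicity of [p] in the polar divisor of [x]. *)
Definition inf_mult p : int := if ord p x < 0 then 1 else 0.

Let x_neq0 : x != 0 := model_neq0 M.

Lemma inf_mult_finite p a : has_value p x a -> inf_mult p = 0.
Proof.
move=> xp; rewrite /inf_mult ltNge; suff -> : 0 <= ord p x by [].
apply/(mpow_ord p 0 x_neq0); rewrite -(subrK (cst a) x).
by apply: mpowD (mpow_const _ _); apply: mpow_mono xp.
Qed.

Lemma inf_mult_inf p : ord p x < 0 -> inf_mult p = 1.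
Proof. by rewrite /inf_mult => ->. Qed.

Lemma inf_mult_inv_point p : inf_mult (inv_point iota p) = inf_mult p.
Proof. by rewrite /inf_mult /= (model_var M). Qed.

Lemma inf_mult_ge0 p : 0 <= inf_mult p.
Proof. by rewrite /inf_mult; case: ifP. Qed.

Lemma ord_x_ge p : - inf_mult p <= ord p x.
Proof.
have [[a xp]|px] := point_cases M p; last first.
  by have [-> _ _ _ _] := model_infinity s_size M px; rewrite inf_mult_inf.
rewrite (inf_mult_finite xp) oppr0; move: (inf_mult_finite xp); rewrite /inf_mult.
by case: ltP.
Qed.

Lemma exists_finite_point a : exists p, has_value p x a.
Proof.
apply: contrapT => nop; have xa0 := model_sub_neq0 M a.
have [p|c xc] := regularE (f := (x - cst a)^-1).
  right; rewrite ordV oppr_ge0 leNgt; apply/negP => xp.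
  by case: nop; exists p; right.
have /eqP := model_var_nonconst M (a + c^-1); apply.
by rewrite rmorphD fmorphV /= -xc invrK subrKC.
Qed.

Lemma exists_infinite_point : exists p, ord p x < 0.
Proof.
apply: contrapT => nop; have [p|c /eqP] := regularE (f := x).
  by right; rewrite leNgt; apply/negP => px; case: nop; exists p.
by rewrite (negPf (model_var_nonconst M c)).
Qed.

(** In other words, [dx / y] has divisor [m - 2] times the polar divisor of [x]. At a branch point
    [2 y dy] is [dx] times the derivative of the branch polynomial, a unit there; at infinity
    [t = 1 / x] gives [dx / dt = - x ^ 2]. *)
Lemma model_unit_derivation d p t : derivation d -> d t = 1 ->
  (forall a, has_value p x a -> a \notin s -> t = x - cst a) ->
  (forall a, has_value p x a -> a \in s -> t = y) ->
  (ord p x < 0 -> t = x^-1) ->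
  ord p (d x) = ord p y + (m%:Z - 2) * inf_mult p.
Proof.
move=> dd dt tn tb ti; have [dD dM dc] := dd; have [_ _ y0 yE] := M.
have [[a xp]|px] := point_cases M p.
  rewrite (inf_mult_finite xp) mulr0 addr0.
  have [as_|as_] := boolP (a \in s); last first.
    have [_ -> _ _] := finite_nonbranch M as_ xp.
    move: dt; rewrite (tn a xp as_) dD derivationN // dc oppr0 addr0 => ->.
    by rewrite ord_one.
  have [_ py _ _] := finite_branch M s_uniq as_ xp.
  have [_ rd] := branch_simple_root s_uniq as_.
  have := derivation_sq y dd; rewrite yE derivation_poly // -(tb a xp as_) dt mulr1 => E.
  have [P0 pP] := ord_unit rd (value_poly (branch_poly s)^`() xp).
  have two0 := two_neq0 X.
  have d0 : d x != 0.
    apply: contra_neq y0 => dx; move/eqP: E; rewrite dx mulr0 eq_sym mulf_eq0 (negPf two0) /=.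
    by rewrite (tb a xp as_) => /eqP.
  have := congr1 (ord p) E; rewrite !ord_mul // ?(tb a xp as_) // pP add0r => ->.
  by rewrite -(rmorph_nat cst) ord_const add0r.
have [ox oy _ _ _] := model_infinity s_size M px.
rewrite oy (inf_mult_inf px); move: dt; rewrite (ti px) (derivationV dd) // => E.
have dE : d x = - x ^+ 2.
  apply: (mulIf (invr_neq0 (expf_neq0 2 x_neq0))); apply: oppr_inj.
  by rewrite -mulNr E mulNr opprK mulfV // expf_neq0.
by rewrite dE ordN ordX // ox; lia.
Qed.

Lemma exists_unit_at p : exists t, [/\ ord p t = 1,
  forall a, has_value p x a -> a \notin s -> t = x - cst a,
  forall a, has_value p x a -> a \in s -> t = y
  & ord p x < 0 -> t = x^-1].
Proof.
have noinf a : has_value p x a -> ord p x < 0 -> False.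
  by move=> /inf_mult_finite + /inf_mult_inf => -> .
have [[a xp]|px] := point_cases M p; last first.
  exists x^-1; have [ox _ _ _ _] := model_infinity s_size M px.
  split=> //; first by rewrite ordV ox.
    by move=> a /noinf /(_ px).
  by move=> a /noinf /(_ px).
have [as_|as_] := boolP (a \in s).
  exists y; have [_ -> _ _] := finite_branch M s_uniq as_ xp; split=> //.
    by move=> b xb; rewrite (has_value_inj xb xp) as_.
  by move=> /(noinf _ xp).
exists (x - cst a); have [-> _ _ _] := finite_nonbranch M as_ xp; split=> //.
- by move=> b xb; rewrite (has_value_inj xb xp).
- by move=> b xb; rewrite (has_value_inj xb xp) (negPf as_).
by move=> /(noinf _ xp).
Qed.

Lemma canonical_formula (KX : divisor X) : canonical_divisor KX ->
  exists2 G, G != 0 & forall p, coeff p KX = ord p G + (m%:Z - 2) * inf_mult p.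
Proof.
case=> g [x0 [g0 [x0c KXE]]]; have [_ _ y0 yE] := M.
(* The derivation [d / dx] is a local derivation [d / dt], taken at any point, divided by its value
   at [x]. *)
have [D [Dd Dx]] : exists D, derivation D /\ D x = 1.
  have [p _] := exists_infinite_point; have [t pt] := ord_onto p.
  have [d [dd dt _]] := KXE p t pt; have [dD dM dc] := dd.
  have dx : d x != 0.
    apply/eqP => /(derivation_model_eq0 M t dd) /eqP; by rewrite dt oner_eq0.
  exists (fun f => (d x)^-1 * d f); split; last by rewrite mulVf.
  split=> [f h|f h|c]; [by rewrite dD mulrDr|by rewrite dM; ring|by rewrite dc mulr0].
have Dx0 : D x0 != 0.
  by apply/eqP => /(derivation_kernel M Dd Dx)[c /eqP]; rewrite (negPf (x0c c)).
(* This is the quotient of the differential [g dx0] by [dx / y]. *)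
exists (g * D x0 * y); first by rewrite !mulf_neq0.
move=> p; have [t [pt tn tb ti]] := exists_unit_at p.
have [d [dd dt ->]] := KXE p t pt.
have := derivation_proportional M x0 Dd dd; rewrite Dx mul1r => ->.
have dx : d x != 0.
  by apply/eqP => /(derivation_model_eq0 M t dd) /eqP; rewrite dt oner_eq0.
rewrite !ord_mul ?mulf_neq0 // (model_unit_derivation dd dt tn tb ti); ring.
Qed.

(* The canonical divisor is equivalent to [m - 2] times the polar divisor of [x], so
   that [1, x, x^2] yield sections if [m >= 4], and sections are constant if [m <= 2]. *)
Lemma genus_two_branch : genus X 2 -> m = 3.
Proof.
case=> KX [/canonical_formula[G G0 KE] VD].
have line_sect f : (forall p, mpow p ((2 - m%:Z) * inf_mult p) f) ->
    global_sections (line_bundle KX) (f / G)%:M.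
  move=> fp p; rewrite /line_bundle /= mxE eqxx mulr1n KE.
  rewrite (_ : - (ord p G + (m%:Z - 2) * inf_mult p) =
    (2 - m%:Z) * inf_mult p + ord p G^-1); last by rewrite ordV; ring.
  by apply: mpowM => //; exact: mpow_self.
have [m4|m3] := leqP 4 m.
  have [i|a [[i ai] aE]] := has_dim_dependent (v := fun i : 'I_3 => (x ^+ i / G)%:M) VD.
    apply: line_sect => p; right; rewrite ordX //.
    have := ord_x_ge p; rewrite /inf_mult; case: ifP => _; have := ltn_ord i; nia.
  pose Q := \poly_(j < 3) a (inord j).
  have Q0 : Q != 0.
    apply/eqP => /(congr1 (fun Q : {poly k} => Q`_i)); rewrite coef_poly coef0 ltn_ord inord_val.
    by move/eqP; rewrite (negPf ai).
  have /eqP[] := model_transcendental M Q0.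
  rewrite /Q poly_def rmorph_sum horner_sum; apply: (mulIf (invr_neq0 G0)); rewrite mul0r mulr_suml.
  have := congr1 (fun A : 'cV[X]_1 => A 0 0) aE; rewrite summxE mxE => E; rewrite -[RHS]E.
  apply: eq_bigr => j _; rewrite /= map_polyZ hornerZ.
  by rewrite map_polyXn hornerXn !mxE inord_val eqxx mulr1n mulrA.
have [m2|m2] := leqP m 2; last by apply/eqP; rewrite eqn_leq m2 -ltnS m3.
have [b [bfree VE]] := VD.
have Vb i : global_sections (line_bundle KX) (b i).
  rewrite VE; exists (fun j => (j == i)%:R).
  rewrite (bigD1 i) //= eqxx rmorph1 scale1r big1 ?addr0 // => j /negPf ->.
  by rewrite rmorph0 scale0r.
have [c bc] : exists c, forall i, b i 0 0 = cst (c i) / G.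
  suff /choice[c bc] : forall i, exists c, b i 0 0 = cst c / G by exists c.
  move=> i; have [p|c bE] := regularE (f := b i 0 0 * G);
    last by exists c; rewrite -[LHS](mulfK G0) bE.
  have := Vb i p; rewrite /line_bundle /= KE => bp.
  apply: (@mpow_mono _ _ _ _ (- (ord p G + (m%:Z - 2) * inf_mult p) + ord p G)).
    by rewrite /inf_mult; case: ifP => _; lia.
  by apply: mpowM => //; exact: mpow_self.
(* Both basis sections are constants over [G], so exchanging these constants with a sign gives a
   linear relation between them. *)
pose a := [ffun j : 'I_2 => if j == 0 then c 1 else - c 0].
have /bfree a0 : \sum_(i < 2) cst (a i) *: b i = 0.
  apply/matrixP => i j; rewrite !ord1 summxE mxE !big_ord_recl big_ord0 !mxE /a !ffunE /=.
  rewrite !bc (_ : fintype.lift ord0 ord0 = 1); last exact/val_inj.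
  by rewrite rmorphN; ring.
have c0 : c 0 = 0 by have := a0 1; rewrite /a ffunE /= => /eqP; rewrite oppr_eq0 => /eqP.
have /bfree /(_ 0) /eqP : \sum_(i < 2) cst ((i == 0)%:R) *: b i = 0.
  rewrite (bigD1 0) //= rmorph1 scale1r big1.
    by rewrite addr0; apply/matrixP => i j; rewrite !ord1 bc c0 rmorph0 mul0r mxE.
  by move=> j /negPf ->; rewrite rmorph0 scale0r.
by rewrite eqxx oner_eq0.
Qed.

Lemma fibre_list a : exists l : seq (closed_point X),
  (forall p, has_value p x a <-> p \in l) /\ \sum_(p <- l) ord p (x - cst a) = 2.
Proof.
have [p xp] := exists_finite_point a; have [as_|as_] := boolP (a \in s).
  have [op _ _ uq] := finite_branch M s_uniq as_ xp.
  exists [:: p]; split; last by rewrite big_seq1.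
  by move=> q; rewrite inE; split=> [/uq->//|/eqP->].
have [op _ _ uq] := finite_nonbranch M as_ xp.
have ixp : has_value (inv_point iota p) x a.
  by apply: value_inv_point; rewrite (model_var M).
exists [:: p; inv_point iota p]; split.
  by move=> q; rewrite !inE; split=> [/uq[]->|/orP[]/eqP->]; rewrite ?eqxx ?orbT.
rewrite !big_cons big_nil; have [-> _ _ _] := finite_nonbranch M as_ xp.
by have [-> _ _ _] := finite_nonbranch M as_ ixp.
Qed.

Lemma infinity_list : exists l : seq (closed_point X),
  (forall p, ord p x < 0 <-> p \in l) /\ size l = 2.
Proof.
have [p px] := exists_infinite_point.
have [_ _ _ uq _] := model_infinity s_size M px.
exists [:: p; inv_point iota p]; split=> // q; rewrite !inE.
split=> [/uq[]->|/orP[]/eqP->//]; rewrite ?eqxx ?orbT //=; by rewrite (model_var M).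
Qed.

Definition finite_support f := exists l : seq (closed_point X), forall p, p \notin l -> ord p f = 0.

Lemma finite_support_mul f g : f != 0 -> g != 0 ->
  finite_support f -> finite_support g -> finite_support (f * g).
Proof.
move=> f0 g0 [l lf] [l' lg]; exists (l ++ l') => p; rewrite mem_cat negb_or => /andP[/lf pf /lg pg].
by rewrite ord_mul // pf pg.
Qed.

Lemma finite_support_poly Q : finite_support (ev x Q).
Proof.
have [->|Q0] := eqVneq Q 0; first by exists [::] => p _; rewrite rmorph0 horner0 ord_zero.
have [r ->] := closed_field_poly_normal Q; rewrite linearZ /= hornerZ -/(branch_poly r) branch_polyE.
have lc0 : cst (lead_coef Q) != 0 by rewrite fmorph_eq0 lead_coef_eq0.
have prod0 r' : \prod_(a <- r') (x - cst a) != 0.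
  by rewrite prodf_seq_neq0; apply/allP => b _; rewrite /= (model_sub_neq0 M).
apply: finite_support_mul => //; first by exists [::] => p _; rewrite ord_const.
elim: r => [|a r IHr]; first by exists [::] => p _; rewrite big_nil ord_one.
rewrite big_cons; apply: finite_support_mul => //; first exact: model_sub_neq0 M a.
have [l [lP _]] := fibre_list a; have [l' [l'P _]] := infinity_list.
exists (l ++ l') => p; rewrite mem_cat negb_or => /andP[/negP pl /negP pl'].
have xa0 := model_sub_neq0 M a.
apply/eqP; rewrite eq_le leNgt; apply/andP; split.
  by apply/negP => xp; case: pl; apply/lP; right.
apply/(mpow_ord p 0 xa0); apply: mpowB (mpow_const _ _); right.
by rewrite leNgt; apply/negP => /l'P.
Qed.

Lemma finite_support_ratfun f : ratfun cst x f -> finite_support f.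
Proof.
move=> [U [V [V0 ->]]]; have [->|U0] := eqVneq (ev x U) 0.
  by exists [::] => p _; rewrite mul0r ord_zero.
apply: finite_support_mul; rewrite ?invr_eq0 //; first exact: finite_support_poly.
by have [l lV] := finite_support_poly V; exists l => p /lV; rewrite ordV => ->.
Qed.

(** Outside the supports of the trace and of the norm, the orders of [f] and [iota f] add up to 0.
    They cannot be opposite and nonzero, since the sum [f + iota f] is regular there. *)
Lemma finite_support_all f : finite_support f.
Proof.
have [->|f0] := eqVneq f 0; first by exists [::] => p _; rewrite ord_zero.
have [Mx _ _ _] := M; have if0 : iota f != 0 by rewrite fmorph_eq0.
have [l lT] : finite_support (f + iota f).
  by apply/finite_support_ratfun/Mx; rewrite rmorphD inv_involutive addrC.
have [l' lN] : finite_support (f * iota f).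
  by apply/finite_support_ratfun/Mx; rewrite rmorphM inv_involutive mulrC.
exists (l ++ l') => p; rewrite mem_cat negb_or => /andP[/lT pT /lN].
rewrite ord_mul // => pN.
have T0 : mpow p 0 (f + iota f) by right; rewrite pT.
have [pf|pf] := leP 0 (ord p f).
  have : mpow p 0 (iota f).
    by rewrite -[iota f](addKr f) addrC; apply: mpowB => //; right.
  by rewrite mpow_ord //; lia.
have : mpow p 0 f.
  rewrite -[f](addrK (iota f)); apply: mpowB => //; right; lia.
by rewrite mpow_ord //; lia.
Qed.

End GlobalGeometry.

(** * The Riemann inequality *)

Section Codimension.
Variables (k : fieldType) (X : curve k) (n : nat).
Local Notation cst := (const X).
Implicit Types (V W : set 'cV[X]_n) (r : 'rV[X]_n) (p : closed_point X).

Definition const_subspace V :=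
  forall (I : finType) (a : I -> k) (b : I -> 'cV[X]_n), (forall i, V (b i)) ->
  V (\sum_i cst (a i) *: b i).

Definition const_free (I : finType) (b : I -> 'cV[X]_n) :=
  forall a : I -> k, \sum_i cst (a i) *: b i = 0 -> forall i, a i = 0.

(** Only lower bounds are tracked, by explicit free families, so [V] may have infinite dimension. *)
Definition dim_ge V N := exists b : 'I_N -> 'cV[X]_n, const_free b /\ forall i, V (b i).

Lemma dim_ge_sub V W N : V `<=` W -> dim_ge V N -> dim_ge W N.
Proof. by move=> VW [b [bf Vb]]; exists b; split=> // i; apply: VW. Qed.

Lemma dim_ge_finType V (I : finType) (b : I -> 'cV[X]_n) :
  const_free b -> (forall i, V (b i)) -> dim_ge V #|I|.
Proof.
move=> bf Vb; exists (fun i => b (enum_val i)); split=> // a a0 i.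
have := bf (fun j => a (enum_rank j)); rewrite (reindex (fun j : 'I_#|I| => enum_val j)) /=; last first.
  exact: onW_bij (@enum_val_bij I).
under eq_bigr => j _ do rewrite enum_valK.
by move=> /(_ a0 (enum_val i)); rewrite enum_valK.
Qed.

Definition functional r (v : 'cV[X]_n) : X := (r *m v) 0 0.

Lemma functional_sum r (I : finType) (a : I -> X) (b : I -> 'cV[X]_n) :
  functional r (\sum_i a i *: b i) = \sum_i a i * functional r (b i).
Proof.
by rewrite /functional mulmx_sumr summxE; apply: eq_bigr => i _; rewrite -scalemxAr mxE.
Qed.

Lemma functionalD r v w : functional r (v + w) = functional r v + functional r w.
Proof. by rewrite /functional mulmxDr mxE. Qed.

Lemma functionalZ r a v : functional r (a *: v) = a * functional r v.
Proof. by rewrite /functional -scalemxAr mxE. Qed.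

Lemma functionalBl r r' v : functional (r - r') v = functional r v - functional r' v.
Proof. by rewrite /functional mulmxBl !mxE. Qed.

Lemma functionalZl r a v : functional (a *: r) v = a * functional r v.
Proof. by rewrite /functional -scalemxAl mxE. Qed.

Definition order_ge p r j : set 'cV[X]_n := [set v | mpow p j (functional r v)].

Lemma const_subspace_order_ge p r j : const_subspace (order_ge p r j).
Proof.
move=> I a b Vb; rewrite /order_ge /= functional_sum; apply: mpow_sum => i _.
by apply: mpow0M (Vb i); apply: mpow_const.
Qed.

Lemma const_subspaceI V W : const_subspace V -> const_subspace W -> const_subspace (V `&` W).
Proof. by move=> sV sW I a b VWb; split; [apply: sV|apply: sW] => i; have [] := VWb i. Qed.

Section AtPoint.
Variable p : closed_point X.
Hypothesis residueP : forall f, mpow p 0 f -> exists c, has_value p f c.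

(** Raising the order by one is a single linear condition over [k]: the leading coefficient, read
    off after multiplication by [t ^ (- j)], must vanish. One vector serves as pivot. *)
Lemma dim_ge_cut1 V N r (j : int) : const_subspace V -> V `<=` order_ge p r j ->
  dim_ge V N.+1 -> dim_ge (V `&` order_ge p r (j + 1)) N.
Proof.
move=> sV Vr [b [bf Vb]]; have [t pt] := ord_onto p.
have t0 : t != 0 by apply/eqP => t0; move: pt; rewrite t0 ord_zero.
have tj l : mpow p l (t ^ l) by right; rewrite ordXz // pt mul1r.
have /choice[c bc] : forall i, exists c, has_value p (functional r (b i) * t ^ (- j)) c.
  by move=> i; apply: residueP; rewrite -(subrr j); apply: mpowM => //; apply: Vr.
(* If every leading coefficient is zero, any pivot will do: the quotients [e l] are then 0 by the
   convention for division by zero, and nothing is subtracted. *)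
have [i0 ci0] : exists i0, c i0 = 0 -> forall i, c i = 0.
  have [[i ci]|nc] := pselect (exists i, c i != 0).
    by exists i => ci0; rewrite ci0 eqxx in ci.
  by exists ord0 => _ i; apply/eqP/negPn/negP => ci; apply: nc; exists i.
pose e l := c (fintype.lift i0 l) / c i0.
have ce l : c (fintype.lift i0 l) = e l * c i0.
  by rewrite /e; have [/ci0->|ci] := eqVneq (c i0) 0; [rewrite !mul0r|rewrite divfK].
pose b' l := b (fintype.lift i0 l) - cst (e l) *: b i0.
have b'E l : b' l = \sum_(i : bool)
    cst (if i then 1 else - e l) *: (if i then b (fintype.lift i0 l) else b i0).
  by rewrite big_bool rmorph1 scale1r rmorphN scaleNr.
exists b'; split=> [a a0 l|l].
  pose a' i := if unlift i0 i is Some l then a l else - \sum_l a l * e l.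
  have /bf/(_ (fintype.lift i0 l)) : \sum_i cst (a' i) *: b i = 0; last by rewrite /a' liftK.
  rewrite (bigD1_ord i0) //= -[RHS]a0 /a' unlift_none rmorphN rmorph_sum scaleNr scaler_suml.
  rewrite addrC -sumrB; apply: eq_bigr => l' _.
  by rewrite liftK /b' scalerBr scalerA rmorphM.
split; first by rewrite b'E; apply: sV => -[].
rewrite /order_ge /=; have -> : functional r (b' l) = (functional r (b' l) * t ^ (- j)) * t ^ j.
  by rewrite -mulrA -expfzDr // addNr expr0z mulr1.
rewrite addrC; apply: mpowM => //; apply: (proj2 (value_zero _ _)).
have -> : functional r (b' l) * t ^ (- j) = functional r (b (fintype.lift i0 l)) * t ^ (- j) +
    cst (- e l) * (functional r (b i0) * t ^ (- j)).
  by rewrite /b' -scaleNr -rmorphN functionalD functionalZ mulrDl mulrA.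
rewrite -(addrN (c (fintype.lift i0 l))) {2}ce -[- (e l * _)]mulNr.
exact: (value_add (bc _) (value_mul (value_const _ _) (bc _))).
Qed.

Lemma dim_ge_cut V N r (j : int) (d : nat) : const_subspace V -> V `<=` order_ge p r j ->
  dim_ge V N -> dim_ge (V `&` order_ge p r (j + d%:Z)) (N - d).
Proof.
move=> sV Vr VN; elim: d => [|d IHd].
  by rewrite subn0 addr0; apply: dim_ge_sub VN => v Vv; split=> //; apply: Vr.
rewrite subnS; case: (N - d)%N IHd => [|N'] IHd /=.
  by exists (fun i => 0); split=> [a _ []|[]].
have := dim_ge_cut1 (const_subspaceI sV (@const_subspace_order_ge p r (j + d%:Z))) _ IHd.
move/(_ r (j + d%:Z)); rewrite -setIA.
rewrite (_ : j + d%:Z + 1 = j + d.+1%:Z); last by rewrite -addrA; congr (_ + _); lia.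
move=> /(_ (@subIsetr _ _ _)); apply: dim_ge_sub.
by move=> v [Vv [_ ?]]; split.
Qed.

End AtPoint.
End Codimension.

Section LocalIndex.
Variables (k : fieldType) (X : curve k) (n : nat) (p : closed_point X).
Hypothesis residueP : forall f, mpow p 0 f -> exists c, has_value p f c.
Implicit Types (V : set 'cV[X]_n) (r : 'rV[X]_n).

(* [u1, u2] are coordinates in a lattice contained in the one with coordinates
   [w1, w2], and [l] is the colength. *)
Lemma dim_ge_lattice_aux V N (u1 u2 w1 w2 : 'rV[X]_n) (a b c d : X) (l : nat) :
  w1 = a *: u1 + b *: u2 -> w2 = c *: u1 + d *: u2 ->
  [/\ mpow p 0 a, mpow p 0 b & mpow p 0 d] -> d != 0 -> mpow p (ord p d) c ->
  a * d - b * c != 0 -> ord p (a * d - b * c) = l ->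
  const_subspace V -> V `<=` order_ge p w1 0 -> V `<=` order_ge p w2 0 ->
  dim_ge V N -> dim_ge (V `&` (order_ge p u1 0 `&` order_ge p u2 0)) (N - l).
Proof.
move=> E1 E2 [a0 b0 d0] dn0 cd Dn0 Dl sV V1 V2 VN.
have c0 : mpow p 0 c by apply: mpow_mono cd; move: d0; rewrite mpow_ord.
have cd0 : mpow p 0 (c / d).
  by rewrite -(subrr (ord p d)); apply: mpowM => //; right; rewrite ordV.
have [e de] : exists e : nat, ord p d = e.
  by move: d0; rewrite mpow_ord //; case: (ord p d) => // e _; exists e.
have [e' De] : exists e' : nat, ord p ((a * d - b * c) / d) = e'.
  have : mpow p 0 ((a * d - b * c) / d).
    rewrite mulrBl mulfK // -mulrA; apply: mpowB => //; exact: mpow0M.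
  rewrite mpow_ord ?mulf_neq0 ?invr_neq0 //.
  by case: (ord p _) => // e' _; exists e'.
have le : l = (e + e')%N.
  by move: De; rewrite ord_divf // Dl de; lia.
have := dim_ge_cut residueP e sV V2 VN; rewrite add0r.
set V' := V `&` _ => V'N.
have sV' : const_subspace V' by apply: const_subspaceI sV (@const_subspace_order_ge _ _ _ _ _ _).
(* This makes the change of coordinates triangular: [r] is a multiple of [u1] alone. The colength
   splits into [e] conditions on [w2] and [e'] conditions on [r]. *)
pose r := w1 - (b / d) *: w2.
have rE : r = ((a * d - b * c) / d) *: u1.
  rewrite /r E1 E2 scalerDr !scalerA divfK // opprD addrACA subrr addr0 -scalerBl.
  by congr (_ *: _); field.
have Vr : V' `<=` order_ge p r (0 : int).
  move=> v [Vv w2v]; rewrite /order_ge /= functionalBl functionalZl.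
  apply: mpowB; first exact: V1.
  rewrite -mulrA; apply: mpow0M => //; rewrite -(subrr e%:Z) addrC.
  by apply: mpowM => //; right; rewrite ordV de.
have := dim_ge_cut residueP e' sV' Vr V'N; rewrite add0r -subnDA -le.
apply: dim_ge_sub => v [[Vv w2v] rv]; split=> //.
have u1v : order_ge p u1 0 v.
  have Dd0 : (a * d - b * c) / d != 0 by rewrite mulf_neq0 ?invr_neq0.
  have -> : u1 = ((a * d - b * c) / d)^-1 *: r by rewrite rE scalerA mulVf ?scale1r.
  rewrite /order_ge /= functionalZl -(subrr e'%:Z) addrC; apply: mpowM => //.
  by right; rewrite ordV De.
split=> //; have -> : u2 = d^-1 *: w2 - (c / d) *: u1.
  by rewrite E2 scalerDr !scalerA mulVf // scale1r [c / d]mulrC addrAC subrr add0r.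
rewrite /order_ge /= functionalBl !functionalZl; apply: mpowB; last exact: mpow0M.
rewrite -(subrr e%:Z) addrC; apply: mpowM => //.
by right; rewrite ordV de.
Qed.

(** Exchanging [u1] and [u2] if necessary, the entry of smaller order in the second row becomes the
    pivot. *)
Lemma dim_ge_lattice V N (u1 u2 w1 w2 : 'rV[X]_n) (a b c d : X) (l : nat) :
  w1 = a *: u1 + b *: u2 -> w2 = c *: u1 + d *: u2 ->
  [/\ mpow p 0 a, mpow p 0 b, mpow p 0 c & mpow p 0 d] ->
  a * d - b * c != 0 -> ord p (a * d - b * c) = l ->
  const_subspace V -> V `<=` order_ge p w1 0 -> V `<=` order_ge p w2 0 ->
  dim_ge V N -> dim_ge (V `&` (order_ge p u1 0 `&` order_ge p u2 0)) (N - l).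
Proof.
move=> E1 E2 [a0 b0 c0 d0] D0 Dl sV V1 V2 VN.
have [[dn0 cd]|[cn0 dc]] : (d != 0 /\ mpow p (ord p d) c) \/ (c != 0 /\ mpow p (ord p c) d).
- have [d00|dn0] := eqVneq d 0.
    by right; split; [apply: contra_neq D0 => ->; rewrite d00 !mulr0 subrr|rewrite d00; left].
  have [->|cn0] := eqVneq c 0; first by left; split=> //; left.
  by have [cd|/ltW cd] := leP (ord p d) (ord p c); [left|right]; split=> //; right.
- exact: dim_ge_lattice_aux E1 E2 _ dn0 cd D0 Dl sV V1 V2 VN.
rewrite [order_ge p u1 0 `&` _]setIC.
have D0' : b * c - a * d != 0 by rewrite -oppr_eq0 opprB.
have Dl' : ord p (b * c - a * d) = l by rewrite -ordN opprB.
have E1' : w1 = b *: u2 + a *: u1 by rewrite addrC.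
have E2' : w2 = d *: u2 + c *: u1 by rewrite addrC.
exact: dim_ge_lattice_aux E1' E2' _ cn0 dc D0' Dl' sV V1 V2 VN.
Qed.

End LocalIndex.

Section Frames.
Variables (k : fieldType) (X : curve k) (n : nat) (E : sheaf X n).
Implicit Types (p : closed_point X) (g : 'M[X]_n) (v : 'cV[X]_n).

Lemma frame_mem p g v : local_frame E p g ->
  E p v <-> forall i, mpow p 0 (functional (row i (invmx g)) v).
Proof.
move=> [gu ->]; have fE i u : functional (row i (invmx g)) u = (invmx g *m u) i 0.
  by rewrite /functional -row_mul mxE.
split=> [[a ap <-] i|vp]; first by rewrite fE mulKmx //; apply: ap.
exists (invmx g *m v); last by rewrite mulKVmx.
by move=> i; rewrite /local_ring -fE.
Qed.

Lemma frame_col p g j : local_frame E p g -> E p (col j g).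
Proof.
move=> [_ ->]; exists (delta_mx j 0); last by rewrite colE.
move=> i; rewrite /local_ring mxE andbT -(rmorph_nat (const X)); exact: mpow_const.
Qed.

Lemma bundle_add p v w : vector_bundle E -> E p v -> E p w -> E p (v + w).
Proof.
move=> [/(_ p)[g gE] _]; rewrite !(frame_mem _ gE) => vp wp i.
by rewrite functionalD; apply: mpowD.
Qed.

Lemma bundle_scale p f v : vector_bundle E -> mpow p 0 f -> E p v -> E p (f *: v).
Proof.
move=> [/(_ p)[g gE] _] fp; rewrite !(frame_mem _ gE) => vp i.
by rewrite functionalZ; apply: mpow0M.
Qed.

Lemma bundle_sum p (I : Type) (r : seq I) (P : pred I) (F : I -> 'cV[X]_n) :
  vector_bundle E -> (forall i, P i -> E p (F i)) -> E p (\sum_(i <- r | P i) F i).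
Proof.
move=> vE FE; apply: (big_ind (E p)) => //; last by move=> v w; apply: bundle_add.
have [/(_ p)[g gE] _] := vE; apply/(frame_mem _ gE) => i.
by rewrite /functional mulmx0 mxE; left.
Qed.

Lemma mpow_det p (M : 'M[X]_n) : (forall i j, mpow p 0 (M i j)) -> mpow p 0 (\det M).
Proof.
move=> Mp; rewrite /determinant; apply: mpow_sum => s _; apply: mpow0M.
  by rewrite -(rmorph_sign (const X)); apply: mpow_const.
apply: (big_ind (mpow p 0)) => //; first by rewrite -(rmorph1 (const X)); apply: mpow_const.
by move=> *; apply: mpow0M.
Qed.

(** [delta] is the single entry of the trivialization. It generates the stalk of the determinant at
    [p], as does [\det g], so the two differ by a unit. *)
Lemma trivial_determinant_frame : trivial_determinant E ->
  exists2 delta, delta != 0 & forall p g, local_frame E p g -> ord p (\det g) = ord p delta.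
Proof.
case=> A [Ainj AE]; pose delta := A 0 0; exists delta.
  apply/eqP => A0; have /matrixP/(_ 0 0)/eqP : (1 : 'M[X]_1) = 0.
    apply: Ainj; rewrite mulmx1; apply/matrixP => i j; by rewrite !ord1 mxE.
  by rewrite !mxE oner_eq0.
move=> p g gE; have [gu Ep] := gE.
have gn0 : \det g != 0 by rewrite -unitfE -unitmxE.
have Ecol (N : 'M[X]_n) : (forall i j, mpow p 0 (N i j)) -> forall j, E p (col j (g *m N)).
  move=> Np j; rewrite Ep; exists (col j N) => [i|]; last first.
    by apply/matrixP => i i'; rewrite !mxE; apply: eq_bigr => l _; rewrite !mxE.
  by rewrite mxE; apply: Np.
have : det_bundle E p (\det g)%:M.
  exists g; split=> // j; rewrite -[g]mulmx1; apply: Ecol => i j'; rewrite mxE.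
  by case: eqP => _ /=; [rewrite -(rmorph1 (const X)); apply: mpow_const|left].
rewrite AE => -[u up] /matrixP/(_ 0 0); rewrite !mxE big_ord1 eqxx mulr1n.
rewrite -[A 0 _ * _]/(delta * u 0 0) => gA.
move: up; rewrite /line_bundle /= coeff0 oppr0 => up.
have u0 : u 0 0 != 0 by apply: contra_neq gn0 => u0; rewrite -gA u0 mulr0.
have d0 : delta != 0 by apply: contra_neq gn0 => d0; rewrite -gA d0 mul0r.
have : det_bundle E p (delta%:M).
  rewrite AE; exists 1%:M.
    by rewrite /line_bundle /= coeff0 oppr0 mxE -(rmorph1 (const X)); apply: mpow_const.
  by rewrite mulmx1; apply/matrixP => i j; rewrite !ord1 mxE eqxx mulr1n.
case=> N [NE] /matrixP/(_ 0 0); rewrite !mxE eqxx !mulr1n => dN.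
have : mpow p 0 (\det (invmx g *m N)).
  apply: mpow_det => i j; rewrite (_ : _ i j = functional (row i (invmx g)) (col j N)).
    exact: (proj1 (frame_mem _ gE) (NE j) i).
  by rewrite /functional !mxE; apply: eq_bigr => l _; rewrite !mxE.
rewrite det_mulmx det_inv -dN mpow_ord ?mulf_neq0 ?invr_neq0 // ord_mul ?invr_neq0 // ordV.
move: up; rewrite mpow_ord // => up; rewrite -gA ord_mul //; lia.
Qed.

Lemma almost_everywhere_standard : vector_bundle E ->
  exists l : seq (closed_point X), forall p, p \notin l -> E p = std_stalk n p.
Proof.
move=> [_ /finite_seqP[l lE]]; exists l => p /negP pl; apply: contrapT => Ep; apply: pl.
by have : [set p | E p <> std_stalk n p] p by []; rewrite lE.
Qed.

Lemma standard_frame p : E p = std_stalk n p -> local_frame E p 1%:M.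
Proof.
move=> Ep; split; first exact: unitmx1.
by rewrite Ep; apply/seteqP; split=> [v vp|_ [v vp <-]]; [exists v; rewrite ?mul1mx|rewrite mul1mx].
Qed.

End Frames.

Section CutAtPoints.
Variables (k : fieldType) (X : curve k) (n : nat).
Implicit Types (V : set 'cV[X]_n).

Lemma dim_ge_cuts V (T : seq (closed_point X)) (W : closed_point X -> set 'cV[X]_n)
    (l : closed_point X -> nat) N :
  const_subspace V -> (forall p, const_subspace (W p)) ->
  (forall p V' N', const_subspace V' -> V' `<=` V -> dim_ge V' N' ->
    dim_ge (V' `&` W p) (N' - l p)) ->
  dim_ge V N ->
  dim_ge (V `&` [set v | forall p, p \in T -> W p v]) (N - \sum_(p <- T) l p).
Proof.
move=> sV sW cut VN; elim: T => [|p T IHT].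
  by rewrite big_nil subn0; apply: dim_ge_sub VN => v; split.
have sVT : const_subspace (V `&` [set v | forall p, p \in T -> W p v]).
  apply: const_subspaceI => // I a b WTb q qT; apply: sW => i; exact: WTb.
rewrite big_cons addnC subnDA; apply: dim_ge_sub (cut p _ _ sVT (@subIsetl _ _ _) IHT).
move=> v [[Vv WTv] Wv]; split=> // q; rewrite in_cons => /orP[/eqP->//|]; exact: WTv.
Qed.

End CutAtPoints.

Lemma det_mx2 (R : comNzRingType) (M : 'M[R]_2) :
  \det M = M 0 0 * M 1 1 - M 0 1 * M 1 0.
Proof.
rewrite (expand_det_row _ 0) !big_ord_recl big_ord0 addr0 /cofactor !det_mx11 !mxE /=.
rewrite addn0 expr0 mul1r expr1 mulN1r mulrN.
by congr (_ * M _ _ - M _ _ * M _ _); apply: val_inj.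
Qed.

(** * Counting the sections of the twisted bundle *)

Section RiemannInequality.
Variables (k : numClosedFieldType) (X : curve k) (iota : involution X).
Implicit Types (f g : X) (P Q : {poly k}) (p q : closed_point X).
Local Notation cst := (const X).
Local Notation ev x P := (map_poly cst P).[x].
Variables (x y : X) (s : seq k) (m : nat).
Hypotheses (s_uniq : uniq s) (s_size : size s = m.*2)
  (M : hyperelliptic_model iota x y (branch_poly s))
  (regularE : forall f, (forall p, mpow p 0 f) -> exists c, f = cst c).

(* A local equation at [p] of the polar divisor of [x]. *)
Definition inf_twist p : X := if ord p x < 0 then x^-1 else 1.

Local Notation theta := inf_twist.
Local Notation inf := (inf_mult x).

Lemma inf_twist_neq0 p : theta p != 0.
Proof. by rewrite /inf_twist; case: ifP; rewrite ?oner_eq0 ?invr_eq0 ?(model_neq0 M). Qed.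

Lemma ord_inf_twist p : ord p (theta p) = inf p.
Proof.
rewrite /inf_twist /inf_mult; case: ifP => px; last exact: ord_one.
by have [ox _ _ _ _] := model_infinity s_size M px; rewrite ordV ox.
Qed.

Lemma ord_y_ge p : - (m%:Z * inf p) <= ord p y.
Proof.
have [[a xp]|px] := point_cases M p; last first.
  have [_ -> _ _ _] := model_infinity s_size M px; rewrite inf_mult_inf //; lia.
rewrite (inf_mult_finite M xp) mulr0 oppr0; have [as_|as_] := boolP (a \in s).
  by have [_ -> _ _] := finite_branch M s_uniq as_ xp.
by have [_ -> _ _] := finite_nonbranch M as_ xp.
Qed.

Lemma model_free P Q : ev x P + ev x Q * y = 0 -> P = 0 /\ Q = 0.
Proof.
move=> PQ; have [_ My y0 _] := M; have := congr1 iota PQ.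
rewrite rmorphD rmorphM rmorph0 !(model_poly M) My mulrN => PQ'.
have ev0 R : ev x R = 0 -> R = 0.
  by move=> R0; apply/eqP/negPn/negP => /(model_transcendental M); rewrite R0 eqxx.
have P0 : ev x P = 0.
  apply: (mulfI (two_neq0 X)); rewrite mulr0 -[RHS](addr0 0) -{1}PQ -PQ'; ring.
by split; apply: ev0 => //; apply: (mulIf y0); rewrite mul0r -PQ P0 add0r.
Qed.

Section PolynomialDivisor.
Variables (A : seq k).
Hypothesis A_uniq : uniq A.
Let F := \prod_(a <- A) (x - cst a).

Lemma prod_sub_neq0 : F != 0.
Proof. by rewrite prodf_seq_neq0; apply/allP => a _; rewrite /= (model_sub_neq0 M). Qed.

Lemma ord_sub_finite p a b : has_value p x a -> a != b -> ord p (x - cst b) = 0.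
Proof.
move=> xp ab; have [] // := @ord_unit _ _ p (x - cst b) (a - b); rewrite ?subr_eq0 //.
by apply: value_add xp _; rewrite /has_value rmorphN subrr; left.
Qed.

Lemma ord_prod_sub p (B : seq k) :
  ord p (\prod_(a <- B) (x - cst a)) = \sum_(a <- B) ord p (x - cst a).
Proof.
elim: B => [|b B IHB]; first by rewrite !big_nil ord_one.
rewrite !big_cons ord_mul ?IHB ?(model_sub_neq0 M) //.
by rewrite prodf_seq_neq0; apply/allP => a _; rewrite /= (model_sub_neq0 M).
Qed.

Lemma ord_prod_mem p a : a \in A -> has_value p x a -> ord p F = ord p (x - cst a).
Proof.
move=> aA xp; rewrite ord_prod_sub (bigD1_seq a) //= big1 ?addr0 // => b ba.
by apply: (ord_sub_finite xp); rewrite eq_sym.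
Qed.

Lemma ord_prod_notin p a : a \notin A -> has_value p x a -> ord p F = 0.
Proof.
move=> aA xp; rewrite ord_prod_sub big1_seq // => b /andP[_ bA].
by apply: (ord_sub_finite xp); apply: contraNneq aA => ->.
Qed.

Lemma ord_prod_inf p : ord p x < 0 -> ord p F = - (size A)%:Z.
Proof.
move=> px; have [ox _ _ _ _] := model_infinity s_size M px.
have oxa a : ord p (x - cst a) = -1.
  have xa0 := model_sub_neq0 M a; apply/eqP; rewrite eq_le; apply/andP; split; last first.
    apply/(mpow_ord p _ xa0); apply: mpowB; first by right; rewrite ox.
    by right; rewrite ord_const.
  rewrite leNgt; apply/negP => oa.
  have : mpow p 0 x.
    rewrite -(subrK (cst a) x); apply: mpowD (mpow_const _ _); right.
    by move: oa; move: (ord p _) => z z1; lia.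
  by rewrite mpow_ord ?(model_neq0 M) // ox.
rewrite ord_prod_sub; elim: (A) => [|b B IHB]; first by rewrite big_nil.
by rewrite big_cons oxa IHB /=; lia.
Qed.

End PolynomialDivisor.

Section Bundle.
Variable E : sheaf X 2.
Hypotheses (vE : vector_bundle E) (detE : trivial_determinant E).

(* The global sections of [E(D)], where [D] is the polar divisor of [x]. *)
Definition twisted_sections : set 'cV[X]_2 := [set v | forall p, E p (theta p *: v)].

Lemma bundle_const_subspace p : const_subspace [set v | E p (theta p *: v)].
Proof.
move=> I a b Eb; rewrite /= scaler_sumr; apply: bundle_sum => // i _.
by rewrite scalerA mulrC -scalerA; apply: bundle_scale => //; [exact: mpow_const|exact: Eb].
Qed.

Lemma entry_bound p (delta : X) (g : 'M[X]_2) : exists K : nat, forall j,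
  mpow p (- K%:Z) (delta^-1 * g 0 j) /\ mpow p (- K%:Z) (g 1 j).
Proof.
have bd f : exists K : nat, forall K', (K <= K')%N -> mpow p (- K'%:Z) f.
  by exists (absz (ord p f)) => K' KK'; right; lia.
have [K1 K1P] := bd (delta^-1 * g 0 0); have [K2 K2P] := bd (delta^-1 * g 0 1).
have [K3 K3P] := bd (g 1 0); have [K4 K4P] := bd (g 1 1).
exists (K1 + K2 + K3 + K4)%N => j.
have [->|->] : j = 0 \/ j = 1 by case: j => -[|[|//]] j2; [left|right]; apply: val_inj.
  by split; [apply: K1P|apply: K3P]; lia.
by split; [apply: K2P|apply: K4P]; lia.
Qed.

(** Dividing the first coordinate by [delta] gives all frames unit determinant, so that only the
    twist will contribute to colengths. The bound [K] is uniform because finitely many points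
    matter. *)
Lemma frames_bound (delta : X) : exists (T : seq (closed_point X)) (K : nat),
  (forall p, p \notin T -> local_frame E p 1%:M /\ ord p delta = 0) /\
  forall p, exists g : 'M[X]_2, local_frame E p g /\ forall j,
    mpow p (- (if p \in T then K%:Z else 0)) (delta^-1 * g 0 j) /\
    mpow p (- (if p \in T then K%:Z else 0)) (g 1 j).
Proof.
have [l1 l1P] := almost_everywhere_standard vE.
have [l2 l2P] := finite_support_all s_uniq s_size M regularE delta.
have [/choice[g gE] _] := vE.
have /choice[K KP] : forall p, exists K : nat, forall j,
  mpow p (- K%:Z) (delta^-1 * g p 0 j) /\ mpow p (- K%:Z) (g p 1 j).
  by move=> p; apply: entry_bound.
pose T := l1 ++ l2; exists T, (\max_(p <- T) K p).
have out p : p \notin T -> local_frame E p 1%:M /\ ord p delta = 0.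
  by rewrite mem_cat negb_or => /andP[/l1P/standard_frame ? /l2P].
split=> // p; have [pT|pT] := boolP (p \in T).
  exists (g p); split=> // j; have [g0 g1] := KP p j.
  have Kp : - (\max_(p <- T) K p)%:Z <= - (K p)%:Z.
    by rewrite lerN2 lez_nat; apply: leq_bigmax_seq.
  by split; apply: mpow_mono Kp _.
have [gE1 dp] := out p pT; exists 1%:M; split=> // j.
have e01 (b : bool) : mpow p 0 (b%:R : X).
  by rewrite -(rmorph_nat cst); apply: mpow_const.
rewrite !mxE oppr0; split=> //; apply: mpow0M => //; right; by rewrite ordV dp.
Qed.

Lemma values_list (T : seq (closed_point X)) : exists A : seq k, uniq A /\
  forall p a, p \in T -> has_value p x a -> a \in A.
Proof.
suff [A AP] : exists A : seq k, forall p a, p \in T -> has_value p x a -> a \in A.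
  exists (undup A); split; first exact: undup_uniq.
  by move=> p a pT xp; rewrite mem_undup; apply: AP xp.
elim: T => [|q T [A AP]]; first by exists [::].
have [[b xq]|nq] := pselect (exists b, has_value q x b).
  exists (b :: A) => p a; rewrite !in_cons => /orP[/eqP-> xa|pT xp].
    by rewrite (has_value_inj xa xq) eqxx.
  by rewrite (AP p) ?orbT.
exists A => p a; rewrite in_cons => /orP[/eqP-> xa|]; [by case: nq; exists a|exact: AP].
Qed.

(* For a suitable polynomial [f] in [x] and a large [mu], the sections are contained
   in the space of all [(delta a / f, b / f)] with [a, b] in
   [k[x]_(<= mu) + y k[x]_(<= mu - m)]; the total colength of the stalks is [4 (mu - 1)]. *)
Lemma riemann_inequality : dim_ge twisted_sections (8 - m.*2).
Proof.
have [delta d0 dE] := trivial_determinant_frame detE.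
have [T0 [K [T0out bound]]] := frames_bound delta.
have [A [A_uniq AP]] := values_list T0.
pose r := size A; pose F := \prod_(a <- A) (x - cst a).
have F0 : F != 0 := prod_sub_neq0 A.
(* At infinity [z] below has order [mu - 1 - K r = m + K], enough to absorb poles of order [K]; and
   [m <= mu] keeps the subtraction [mu - m] exact. *)
pose mu := (m + K * r + K + 1)%N.
pose f := F ^+ K; have f0 : f != 0 by rewrite expf_neq0.
have of_ p : ord p f = ord p F * K%:Z by rewrite ordX.
have Ffin p a : has_value p x a -> 0 <= ord p F.
  move=> xp; have [aA|aA] := boolP (a \in A); last by rewrite (ord_prod_notin aA xp).
  by rewrite (ord_prod_mem A_uniq aA xp); move: xp; rewrite /has_value mpow_ord ?(model_sub_neq0 M) //; lia.
have FA p a : a \in A -> has_value p x a -> 1 <= ord p F.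
  move=> aA xp; rewrite (ord_prod_mem A_uniq aA xp).
  by move: xp; rewrite /has_value mpow_ord ?(model_sub_neq0 M).
pose row0 : 'rV[X]_2 := delta_mx 0 0; pose row1 : 'rV[X]_2 := delta_mx 0 1.
pose w1 p := (theta p ^+ mu * f / delta) *: row0.
pose w2 p := (theta p ^+ mu * f) *: row1.
pose V0 := [set v | forall p, order_ge p (w1 p) 0 v /\ order_ge p (w2 p) 0 v].
have sV0 : const_subspace V0.
  by move=> I a b Vb p; split; apply: const_subspace_order_ge => i; have [] := Vb i p.
pose W p := [set v | E p (theta p *: v)].
(* The colength at [p] of the stalk of [E(D)] in the lattice with coordinates [w1 p] and [w2 p]. It
   is twice the order of [z] below; [absz] only makes it a natural number. *)
pose l p := absz (2 * (mu%:Z - 1) * inf p + 2 * ord p f).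
have rowE' i v : functional (delta_mx 0 i) v = v i 0 by rewrite /functional -rowE mxE.
have dimV0 : dim_ge V0 (2 * (2 * mu + 2 - m))%N.
  (* Monomials with poles of order at most [mu] at infinity, where [y] has order [- m]; there are
     [(mu + 1) + (mu - m + 1)] of them for each of the two coordinates. *)
  pose I := (('I_mu.+1 + 'I_(mu - m).+1) * bool)%type.
  pose h (i : 'I_mu.+1 + 'I_(mu - m).+1) := match i with inl j => x ^+ j | inr j => x ^+ j * y end.
  pose e (c : bool) : 'cV[X]_2 := if c then (delta / f) *: delta_mx 0 0 else f^-1 *: delta_mx 1 0.
  pose b (i : I) := h i.1 *: e i.2.
  have -> : (2 * (2 * mu + 2 - m) = #|{: I}|)%N.
    by rewrite card_prod card_sum !card_ord card_bool /mu; lia.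
  apply: (@dim_ge_finType _ _ _ _ _ b).
    move=> a a0.
    have comp c : \sum_i cst (a (i, c)) * h i = 0.
      pose j : 'I_2 := if c then 0 else 1.
      have ej c' : e c' j 0 = if c' == c then (if c then delta / f else f^-1) else 0.
        by rewrite /e /j {j}; case: c; case: c'; rewrite !mxE /= ?mulr1 ?mulr0.
      have ec0 : (if c then delta / f else f^-1) != 0.
        by case: (c); rewrite ?mulf_neq0 ?invr_neq0.
      apply: (mulIf ec0); rewrite mul0r.
      have := congr1 (fun v : 'cV[X]_2 => v j 0) a0; rewrite summxE mxE => E0.
      rewrite -[RHS]E0 mulr_suml.
      transitivity (\sum_i \sum_c' (cst (a (i, c')) *: b (i, c')) j 0); last first.
        by rewrite pair_bigA; apply: eq_bigr => -[].
      apply: eq_bigr => i _; rewrite (bigD1 c) //= big1 ?addr0 => [|c' /negPf c'c].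
        by rewrite !mxE ej eqxx mulrA.
      by rewrite !mxE ej c'c !mulr0.
    have poly (n : nat) (u : 'I_n.+1 -> k) :
        \sum_(i < n.+1) cst (u i) * x ^+ i = ev x (\poly_(i < n.+1) u (inord i)).
      rewrite poly_def rmorph_sum horner_sum; apply: eq_bigr => i _.
      by rewrite /= map_polyZ map_polyXn hornerZ hornerXn inord_val.
    have poly0 (n : nat) (u : 'I_n.+1 -> k) : \poly_(i < n.+1) u (inord i) = 0 -> forall i, u i = 0.
      move=> u0 i; have := congr1 (fun Q : {poly k} => Q`_i) u0.
      by rewrite coef_poly coef0 ltn_ord inord_val.
    move=> [i c]; have := comp c; rewrite big_sumType /=.
    under [X in _ + X]eq_bigr => l' _ do rewrite mulrA.
    rewrite -mulr_suml (poly _ (fun i => a (inl i, c))) (poly _ (fun i => a (inr i, c))).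
    case/model_free => c1 c2; case: i => i.
      exact: (poly0 _ (fun i => a (inl i, c)) c1).
    exact: (poly0 _ (fun i => a (inr i, c)) c2).
  have h_ge p i : mpow p (- (mu%:Z * inf p)) (h i).
    have xg := ord_x_ge s_size M p; have yg := ord_y_ge p; have i0 := inf_mult_ge0 x p.
    have x0 := model_neq0 M; have [_ _ y0 _] := M.
    case: i => j; right; rewrite /h ?ord_mul ?expf_neq0 // ordX //; have := ltn_ord j.
      by move: (ord p x) (inf p) xg i0 => ox ip xg i0 jm; nia.
    move: (ord p x) (ord p y) (inf p) xg yg i0 => ox oy ip xg yg i0 jm.
    by rewrite /mu in jm *; nia.
  have th_reg p i : mpow p 0 (theta p ^+ mu * h i).
    have -> : 0 = ord p (theta p) * mu%:Z + - (mu%:Z * inf p) by rewrite ord_inf_twist; ring.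
    by apply: mpowM => //; right; rewrite ordX ?inf_twist_neq0.
  move=> [i c] p; rewrite /order_ge /= !functionalZl !rowE' /b /e /=.
  have fd0 : f != 0 /\ delta != 0 by [].
  case: c; rewrite !mxE /= ?mulr0 ?mulr1; split; try by left.
  - by rewrite (_ : _ * _ = theta p ^+ mu * h i) //; field; rewrite f0 d0.
  - by rewrite (_ : _ * _ = theta p ^+ mu * h i) //; field; rewrite f0.
have cut p V' N' : const_subspace V' -> V' `<=` V0 -> dim_ge V' N' ->
    dim_ge (V' `&` W p) (N' - l p).
  move=> sV' V'V0 V'N; have [g [gE gb]] := bound p; have [gu _] := gE.
  pose u i : 'rV[X]_2 := theta p *: row i (invmx g).
  have t0 := inf_twist_neq0 p.
  have rowg i : delta_mx 0 i = g i 0 *: row 0 (invmx g) + g i 1 *: row 1 (invmx g).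
    rewrite -[LHS]mulmx1 -(mulmxV gu) mulmxA -rowE mulmx_sum_row big_ord_recl big_ord1.
    have -> : fintype.lift ord0 ord0 = 1 :> 'I_2 by apply: val_inj.
    by rewrite !mxE.
  (* One factor [theta p] is set apart because the coordinates [u i] of [E(D)] already contain
     it. *)
  pose z := theta p ^+ (mu - 1) * f.
  have muE : theta p ^+ mu = theta p ^+ (mu - 1) * theta p.
    by rewrite -exprSr; congr (_ ^+ _); rewrite /mu; lia.
  have oz : ord p z = (mu%:Z - 1) * inf p + ord p f.
    rewrite /z ord_mul ?expf_neq0 // ordX // ord_inf_twist /mu; congr (_ + _).
    by rewrite mulrC; congr (_ * _); lia.
  have z0 : z != 0 by rewrite mulf_neq0 ?expf_neq0.
  have zint e : mpow p (- (if p \in T0 then K%:Z else 0)) e -> mpow p 0 (z * e).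
    move=> ep; have : (if p \in T0 then K%:Z else 0) <= ord p z.
      rewrite oz of_; have [[a xp]|px] := point_cases M p.
        rewrite (inf_mult_finite M xp) mulr0 add0r.
        have F1 := Ffin p a xp; case: ifP => pT; last by rewrite mulr_ge0.
        by have := FA p a (AP p a pT xp) xp; move: (ord p F) => oF ?; nia.
      rewrite (inf_mult_inf px) (ord_prod_inf A_uniq px) -/r /mu.
      case: ifP => _; lia.
    move=> zK; rewrite -(subrr (if p \in T0 then K%:Z else 0)); apply: mpowM => //.
    by right.
  have [g00 g10] := gb 0; have [g01 g11] := gb 1.
  have dz : z * (delta^-1 * g 0 0) * (z * g 1 1) - z * (delta^-1 * g 0 1) * (z * g 1 0) =
      z ^+ 2 * (\det g / delta).
    by rewrite det_mx2; field.
  have detg0 : \det g != 0 by rewrite -unitfE -unitmxE.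
  have dzn : z ^+ 2 * (\det g / delta) != 0 by rewrite !mulf_neq0 ?invr_neq0 ?expf_neq0.
  have odz : ord p (z ^+ 2 * (\det g / delta)) = l p.
    rewrite ord_mul ?mulf_neq0 ?invr_neq0 ?expf_neq0 // ord_divf // (dE _ _ gE) subrr addr0.
    rewrite ordX // /l.
    have : mpow p 0 (z ^+ 2 * (\det g / delta)).
      rewrite -dz; apply: mpowB; apply: mpow0M; exact: zint.
    rewrite mpow_ord // ord_mul ?mulf_neq0 ?invr_neq0 ?expf_neq0 // ord_divf // (dE _ _ gE) subrr.
    rewrite addr0 ordX // oz; lia.
  have E1 : w1 p = (z * (delta^-1 * g 0 0)) *: u 0 + (z * (delta^-1 * g 0 1)) *: u 1.
    rewrite /w1 /row0 rowg scalerDr !scalerA muE /z; congr (_ *: _ + _ *: _); field; exact: d0.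
  have E2 : w2 p = (z * g 1 0) *: u 0 + (z * g 1 1) *: u 1.
    rewrite /w2 /row1 rowg scalerDr !scalerA muE /z; congr (_ *: _ + _ *: _); ring.
  have res := @residue _ _ _ _ _ _ _ s_size M s_uniq p.
  have := dim_ge_lattice res E1 E2 _ _ _ sV' _ _ V'N; rewrite dz.
  move=> /(_ (l p)) H; apply: dim_ge_sub (H _ dzn odz _ _).
  - move=> v [V'v [u0v u1v]]; split=> //; apply/(frame_mem _ gE) => i.
    rewrite functionalZ; have [->|->] : i = 0 \/ i = 1.
      by case: i => -[|[|//]] i2; [left|right]; apply: val_inj.
      by move: u0v; rewrite /order_ge /= functionalZl.
    by move: u1v; rewrite /order_ge /= functionalZl.
  - by split; apply: zint.
  - by move=> v /V'V0/(_ p)[].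
  - by move=> v /V'V0/(_ p)[].
have [lA lAP] : exists lA : seq (closed_point X),
    (forall p a, a \in A -> has_value p x a -> p \in lA) /\
    (\sum_(p <- lA) l p = 4 * K * r)%N.
  have /choice[L LP] := fibre_list s_uniq M regularE; exists (flatten [seq L a | a <- A]); split.
    move=> p a aA /(LP a).1 pL; apply/flattenP; exists (L a) => //.
    by apply/mapP; exists a.
  rewrite big_flatten big_map.
  have -> : (\sum_(a <- A) \sum_(p <- L a) l p = \sum_(a <- A) 4 * K)%N.
    apply: eq_big_seq => a aA; have [LP1 LP2] := LP a.
    suff : (\sum_(p <- L a) l p)%:Z = (4 * K)%:Z by case.
    rewrite (big_morph Posz PoszD (erefl _)).
    have -> : (4 * K)%:Z = \sum_(p <- L a) ord p (x - cst a) * (2 * K%:Z).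
      by rewrite -mulr_suml LP2; lia.
    apply: eq_big_seq => p /LP1 xp; rewrite /l of_ (inf_mult_finite M xp).
    have := FA p a aA xp; rewrite (ord_prod_mem A_uniq aA xp).
    by move: (ord p _) => o o1; nia.
  by rewrite big_const_seq count_predT iter_addn_0.
have [linf [linfP linf2]] := infinity_list s_size M regularE.
have := dim_ge_cuts (lA ++ linf) sV0 bundle_const_subspace cut dimV0.
rewrite big_cat (proj2 lAP).
have -> : (\sum_(p <- linf) l p = 2 * (2 * (mu - 1) - 2 * K * r))%N.
  have -> : (\sum_(p <- linf) l p = \sum_(p <- linf) (2 * (mu - 1) - 2 * K * r))%N.
    apply: eq_big_seq => p /linfP px; rewrite /l of_ (inf_mult_inf px) (ord_prod_inf A_uniq px) -/r /mu.
    by nia.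
  by rewrite big_const_seq count_predT iter_addn_0 linf2 mulnC.
(* The zeros and the poles of [f] cancel, which leaves [4 mu + 4 - 2 m - 4 (mu - 1)]. *)
have -> : (2 * (2 * mu + 2 - m) - (4 * K * r + 2 * (2 * (mu - 1) - 2 * K * r)) = 8 - m.*2)%N.
  by rewrite /mu; nia.
apply: dim_ge_sub => v [V0v Wv] p.
(* Elsewhere no condition was imposed and none is needed: [delta], [f] and [theta] are units and [E]
   is standard there. *)
have [pT|pT] := boolP (p \in lA ++ linf); first exact: Wv.
have [pA pinf] : p \notin lA /\ p \notin linf.
  by move: pT; rewrite mem_cat negb_or => /andP[].
have [[a xp]|/linfP pl] := point_cases M p; last by rewrite pl in pinf.
have aA : a \notin A by apply: contraNN pA => aA; apply: (proj1 lAP) aA xp.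
have pT0 : p \notin T0 by apply: contraNN aA => pT0; apply: AP pT0 xp.
have [gE op] := T0out p pT0.
have of0 : ord p f = 0 by rewrite of_ (ord_prod_notin aA xp) mul0r.
have th1 : theta p = 1.
  rewrite /inf_twist; case: ifP => // px.
  by have := inf_mult_inf px; rewrite (inf_mult_finite M xp).
have [v1 v2] := V0v p; move: v1 v2; rewrite /order_ge /= /w1 /w2 !functionalZl !rowE'.
rewrite th1 expr1n !mul1r => v1 v2; rewrite scale1r; apply/(frame_mem _ gE) => i.
rewrite invmx1 rowE mulmx1 rowE'.
have unit_mul (u e : X) : u != 0 -> ord p u = 0 -> mpow p 0 (u * e) -> mpow p 0 e.
  by move=> u0 ou ue; rewrite -(mulKf u0 e); apply: mpow0M => //; right; rewrite ordV ou.
have [->|->] : i = 0 \/ i = 1.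
- by case: i => -[|[|//]] i2; [left|right]; apply: val_inj.
- by apply: unit_mul v1; rewrite ?mulf_neq0 ?invr_neq0 // ord_divf // of0 op.
- exact: unit_mul v2.
Qed.

End Bundle.

End RiemannInequality.

(** * Saturation and fibres *)

Section Saturation.
Variables (k : fieldType) (X : curve k).
Implicit Types (p : closed_point X) (f : X) (v u : 'cV[X]_2).
Local Notation cst := (const X).

Lemma mpow_inj p (a b : int) : (forall f, mpow p a f <-> mpow p b f) -> a = b.
Proof.
move=> ab; have [t pt] := ord_onto p.
have t0 : t != 0 by apply/eqP => t0; move: pt; rewrite t0 ord_zero.
have tj l : ord p (t ^ l) = l by rewrite ordXz // pt mul1r.
have := proj1 (ab (t ^ a)); rewrite !mpow_ord ?expfz_neq0 // tj => /(_ (lexx _)) ba.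
have := proj2 (ab (t ^ b)); rewrite !mpow_ord ?expfz_neq0 // tj => /(_ (lexx _)); lia.
Qed.

Lemma ord2_cases (i : 'I_2) : i = 0 \/ i = 1.
Proof. by case: i => -[|[|//]] i2; [left|right]; apply: val_inj. Qed.

(** The inverse of [N] is integral as well, by the cofactor formula with a unit determinant. *)
Lemma frame_change n (E : sheaf X n) p (g N : 'M[X]_n) : local_frame E p g ->
  (forall i j, mpow p 0 (N i j)) -> \det N != 0 -> ord p (\det N) = 0 ->
  local_frame E p (g *m N).
Proof.
move=> [gu Ep] Np N0 oN; have Nu : N \in unitmx by rewrite unitmxE unitfE.
have integral (B : 'M[X]_n) a : (forall i j, mpow p 0 (B i j)) -> std_stalk n p a ->
    std_stalk n p (B *m a).
  by move=> Bp ap i; rewrite /local_ring mxE; apply: mpow_sum => j _; apply: mpow0M => //; apply: ap.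
split; first by rewrite unitmx_mul gu.
rewrite Ep; apply/seteqP; split=> [_ [a ap <-]|_ [a ap <-]]; last first.
  by exists (N *m a); [apply: integral|rewrite mulmxA].
exists (invmx N *m a); last by rewrite -mulmxA mulKVmx.
apply: integral => // i j; rewrite /invmx Nu !mxE.
apply: mpow0M; first by right; rewrite ordV oN.
rewrite /cofactor; apply: mpow0M.
  by rewrite -(rmorph_sign cst); apply: mpow_const.
by apply: mpow_det => i' j'; rewrite !mxE.
Qed.

Section Bundle.
Variable E : sheaf X 2.
Hypothesis vE : vector_bundle E.

(* [n] is the order of vanishing at [p] of [v], as a rational section of [E]. *)
Lemma saturation p v : v != 0 -> exists (n : int) (g : 'M[X]_2) (r : X),
  [/\ local_frame E p g, r != 0, ord p r = - n, col 0 g = r *: v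
    & forall f, E p (f *: v) <-> mpow p (- n) f].
Proof.
move=> v0; have [/(_ p)[g gE] _] := vE; have [gu _] := gE.
pose u i := functional (row i (invmx g)) v.
have uE : invmx g *m v = \col_i u i.
  by apply/matrixP => i j; rewrite !ord1 [RHS]mxE /u /functional -row_mul [RHS]mxE.
have [i0 [ui0 umin]] : exists i0, u i0 != 0 /\ forall j, mpow p (ord p (u i0)) (u j).
  have [u0|u0] := eqVneq (u 0) 0; have [u1|u1] := eqVneq (u 1) 0.
  - case/eqP: v0; rewrite -(mulKVmx gu v) uE; apply/matrixP => i j; rewrite [LHS]mxE big1 ?mxE // => l _.
    by rewrite [X in _ * X]mxE; have [->|->] := ord2_cases l; rewrite ?u0 ?u1 mulr0.
  - by exists 1; split=> // j; have [->|->] := ord2_cases j; rewrite ?u0; [left|right].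
  - by exists 0; split=> // j; have [->|->] := ord2_cases j; rewrite ?u1; [right|left].
  have [le01|/ltW le10] := leP (ord p (u 0)) (ord p (u 1)).
    by exists 0; split=> // j; have [->|->] := ord2_cases j; right.
  by exists 1; split=> // j; have [->|->] := ord2_cases j; right.
pose r := (u i0)^-1.
(* The first column holds the coordinates of [v], scaled so that the one of least order becomes 1;
   the second is the other basis vector, so the determinant is 1 or -1. *)
pose N : 'M[X]_2 := \matrix_(i, j) if j == 0 then r * u i else (i != i0)%:R.
have ru0 : r * u i0 = 1 by rewrite mulVf.
have detN : \det N = if i0 == 0 then 1 else -1.
  rewrite det_mx2 !mxE /=; case: (ord2_cases i0) ru0 => ->; rewrite /= => ->.
    by rewrite mul0r subr0 mulr1.
  by rewrite mulr0 mul1r sub0r.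
exists (ord p (u i0)), (g *m N), r; split.
- apply: frame_change => //.
  + move=> i j; rewrite mxE; case: ifP => _.
      by rewrite -(addNr (ord p (u i0))); apply: mpowM => //; right; rewrite ordV.
    by rewrite -(rmorph_nat cst); apply: mpow_const.
  + by rewrite detN; case: ifP; rewrite ?oppr_eq0 oner_eq0.
  + by rewrite detN; case: ifP => _; rewrite ?ordN ord_one.
- by rewrite invr_eq0.
- by rewrite ordV.
- rewrite -[X in _ = _ *: X](mulKVmx gu v) uE scalemxAr; apply/matrixP => i j; rewrite mxE [LHS]mxE [RHS]mxE.
  by apply: eq_bigr => l _; rewrite !mxE.
move=> f; rewrite (frame_mem _ gE); split=> [/(_ i0)|fp i].
  rewrite functionalZ -/(u i0) => fu; rewrite -[f](mulfK ui0) -[- _]add0r.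
  by apply: mpowM => //; right; rewrite ordV.
by rewrite functionalZ -/(u i) -(addNr (ord p (u i0))); apply: mpowM.
Qed.

Definition saturated_line v : sheaf X 2 := fun p => [set w | E p w /\ exists f, w = f *: v].

Lemma saturated_line_subbundle v : v != 0 -> line_subbundle E (saturated_line v).
Proof.
move=> v0; split; first by exists v; split=> // p w [_ [f wE]]; exists f.
move=> p; have [n [g [r [gE r0 rn gr vp]]]] := saturation p v0; exists g; split=> //.
rewrite gr; apply/seteqP; split=> [w [Ew [f wE]]|_ [a ap <-]].
  have fn := Ew; rewrite wE vp in fn; exists (f / r); last by rewrite scalerA divfK // wE.
  by rewrite /local_ring -(addNr n); apply: mpowM => //; right; rewrite ordV rn opprK.
rewrite scalerA; split; last by exists (a * r).
by apply/vp; apply: mpow0M => //; right; rewrite rn.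
Qed.

Definition vanishing_order v p (n : int) := forall f, E p (f *: v) <-> mpow p (- n) f.

Lemma saturated_line_degree v (n : closed_point X -> int) (D : divisor X) : v != 0 ->
  (forall p, vanishing_order v p (n p)) -> (forall p, coeff p D = n p) ->
  line_degree (saturated_line v) (deg D).
Proof.
move=> v0 vn Dn; exists D; split=> //; exists v; split.
  move=> c; rewrite [c]mx11_scalar mul_mx_scalar => /eqP; rewrite scaler_eq0 (negPf v0) orbF => /eqP ->.
  by apply/matrixP => i j; rewrite !mxE mul0rn.
move=> p; apply/seteqP; split=> [w [Ew [f wE]]|_ [c cD <-]].
  exists f%:M; last by rewrite mul_mx_scalar wE.
  by rewrite /line_bundle /= mxE eqxx mulr1n Dn; apply: (proj1 (vn p f)); rewrite -wE.
rewrite [c]mx11_scalar mul_mx_scalar; split; last by exists (c 0 0).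
by apply/vn; rewrite -Dn.
Qed.

Lemma divisor_of (n : closed_point X -> int) (l : seq (closed_point X)) :
  (forall p, p \notin l -> n p = 0) -> exists D : divisor X, forall p, coeff p D = n p.
Proof.
move=> nl; exists (\sum_(q <- undup l) << n q *g q >>) => p.
rewrite raddf_sum /=; have [pl|pl] := boolP (p \in undup l).
  rewrite (bigD1_seq p) ?undup_uniq //= coeffU eqxx mulr1 big1 ?addr0 // => q qp.
  by rewrite coeffU (negPf qp) mulr0.
rewrite big1_seq => [|q /andP[_ ql]]; first by rewrite nl // -mem_undup.
by rewrite coeffU; case: eqP pl => [<-|_ _]; rewrite ?ql // mulr0.
Qed.

(** The submodule [m_p E_p]. Single products are enough, without sums, because [m_p] is
    principal. *)
Definition maximal_stalk p : set 'cV[X]_2 :=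
  [set w | exists f u, [/\ maximal_ideal p f, E p u & w = f *: u]].

Lemma maximal_stalk_frame p g w : local_frame E p g ->
  maximal_stalk p w <-> forall i, mpow p 1 (functional (row i (invmx g)) w).
Proof.
move=> gE; split=> [[f [u [fp up ->]]] i|wp].
  by rewrite functionalZ; apply: mpowM0 => //; apply: (proj1 (frame_mem _ gE) up).
have [t pt] := ord_onto p.
have t0 : t != 0 by apply/eqP => t0; move: pt; rewrite t0 ord_zero.
exists t, (t^-1 *: w); split; last by rewrite scalerA mulfV // scale1r.
  by right; rewrite pt.
apply/(frame_mem _ gE) => i; rewrite functionalZ -(addNr 1); apply: mpowM => //.
by right; rewrite ordV pt.
Qed.

Lemma maximal_stalkD p u w : maximal_stalk p u -> maximal_stalk p w -> maximal_stalk p (u + w).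
Proof.
have [/(_ p)[g gE] _] := vE; rewrite !(maximal_stalk_frame _ gE) => up wp i.
by rewrite functionalD; apply: mpowD.
Qed.

Lemma maximal_stalkZ p f w : mpow p 0 f -> maximal_stalk p w -> maximal_stalk p (f *: w).
Proof.
have [/(_ p)[g gE] _] := vE; rewrite !(maximal_stalk_frame _ gE) => fp wp i.
by rewrite functionalZ; apply: mpow0M.
Qed.

Lemma maximal_stalkB p u w : maximal_stalk p u -> maximal_stalk p w -> maximal_stalk p (u - w).
Proof.
move=> up wp; apply: maximal_stalkD => //; rewrite -scaleN1r; apply: maximal_stalkZ => //.
by rewrite -(rmorph1 cst) -rmorphN; apply: mpow_const.
Qed.

Lemma fibre_classP p u w : fibre_class E p u = fibre_class E p w <-> maximal_stalk p (u - w).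
Proof.
have Eu0 : E p 0.
  have [/(_ p)[g gE] _] := vE; apply/(frame_mem _ gE) => i.
  by rewrite /functional mulmx0 mxE; left.
have self z : fibre_class E p z z.
  by exists 0, 0; split=> //; [left|rewrite scaler0 addr0].
split=> [uw|uw].
  have : fibre_class E p w u by rewrite -uw; apply: self.
  case=> f [z [fp zp ->]]; exists f, z; split=> //; by rewrite addrAC subrr add0r.
apply/seteqP; split=> z [f [z' [fp zp ->]]].
  have [f' [z'' [fp' zp' E']]] : maximal_stalk p ((u - w) + f *: z').
    by apply: maximal_stalkD => //; exists f, z'.
  by exists f', z''; split=> //; rewrite -E' addrA subrKC.
have [f' [z'' [fp' zp' E']]] : maximal_stalk p (f *: z' - (u - w)).
  by apply: maximal_stalkB => //; exists f, z'.
by exists f', z''; split=> //; rewrite -E' opprB addrCA subrKC addrC.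
Qed.

(** As the residue field is [k], the fibre is a plane over [k], in which two independent vectors
    form a basis. *)
Lemma fibre_basis p v1 v2 u : (forall f, mpow p 0 f -> exists c, has_value p f c) ->
  E p v1 -> E p v2 -> E p u ->
  (forall c1 c2 : k, maximal_stalk p (cst c1 *: v1 + cst c2 *: v2) -> c1 = 0 /\ c2 = 0) ->
  exists c1 c2 : k, maximal_stalk p (u - (cst c1 *: v1 + cst c2 *: v2)).
Proof.
move=> res E1 E2 Eu free; have [/(_ p)[g gE] _] := vE.
have val w : E p w -> exists c : 'I_2 -> k, forall i, has_value p (functional (row i (invmx g)) w) (c i).
  move=> Ew; suff /choice[c cP] : forall i, exists c, has_value p (functional (row i (invmx g)) w) c.
    by exists c.
  by move=> i; apply: res; apply: (proj1 (frame_mem _ gE) Ew).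
have [a aP] := val v1 E1; have [b bP] := val v2 E2; have [d dP] := val u Eu.
pose C : 'M[k]_2 := \matrix_(i, j) if i == 0 then a j else b j.
have value_comb c1 c2 i : has_value p (functional (row i (invmx g)) (cst c1 *: v1 + cst c2 *: v2))
    (c1 * a i + c2 * b i).
  rewrite functionalD !functionalZ; apply: value_add; apply: value_mul => //; exact: value_const.
have Cu : C \in unitmx.
  rewrite -row_free_unit -kermx_eq0; apply/rowV0P => c /sub_kermxP cC.
  have [c0 c1] : c 0 0 = 0 /\ c 0 1 = 0.
    apply: free; apply/(maximal_stalk_frame _ gE) => i; apply: (proj2 (value_zero _ _)).
    have := congr1 (fun B : 'rV[k]_2 => B 0 i) cC; rewrite !mxE !big_ord_recl big_ord0 !mxE /= addr0.
    by rewrite (_ : fintype.lift ord0 ord0 = 1); [move=> <-; exact: value_comb|exact: val_inj].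
  by apply/matrixP => i j; rewrite !ord1 mxE; have [->|->] := ord2_cases j.
have [e eC] : exists e : 'rV[k]_2, e *m C = \row_j d j.
  by exists ((\row_j d j) *m invmx C); rewrite mulmxKV.
exists (e 0 0), (e 0 1).
apply/(maximal_stalk_frame _ gE) => i; apply: (proj2 (value_zero _ _)).
have eE : e 0 0 * a i + e 0 1 * b i = d i.
  have := congr1 (fun B : 'rV[k]_2 => B 0 i) eC; rewrite !mxE !big_ord_recl big_ord0 !mxE /= addr0.
  by rewrite (_ : fintype.lift ord0 ord0 = 1) //; exact: val_inj.
rewrite -scaleN1r functionalD functionalZ -(subrr (d i)); apply: value_add => //.
rewrite -[- d i]mulN1r -eE; apply: value_mul; last exact: value_comb.
by rewrite /has_value rmorphN1 subrr; left.
Qed.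

End Bundle.
End Saturation.

(** * Eigensections *)

Lemma deg_ge0 (K : choiceType) (D : {freeg K / int}) :
  (forall z, 0 <= coeff z D) -> 0 <= deg D.
Proof.
move=> D0; rewrite -(freeg_sumE D) raddf_sum /=; apply: sumr_ge0 => z _.
by rewrite degU.
Qed.

Section EigenSections.
Variables (k : numClosedFieldType) (X : curve k) (iota : involution X).
Implicit Types (f : X) (p q w : closed_point X) (u v : 'cV[X]_2) (e c : k).
Local Notation cst := (const X).
Variables (x y : X) (s : seq k).
Hypotheses (s_uniq : uniq s) (s_size : size s = 3.*2)
  (M : hyperelliptic_model iota x y (branch_poly s))
  (regularE : forall f, (forall p, mpow p 0 f) -> exists c, f = cst c).
Variables (E : sheaf X 2) (H : 'M[X]_2).
Hypotheses (vE : vector_bundle E) (stE : stable E) (detE : trivial_determinant E)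
  (gunningE : forall w, weierstrass iota w -> ~ odd_gunning_plane E w)
  (liftH : is_lift iota E H).

Local Notation theta := (inf_twist x).
Local Notation inf := (inf_mult x).
Local Notation sections := (twisted_sections x E).
Local Notation sigma := (fibre_act iota H).
Let residueX : forall p f, mpow p 0 f -> exists c, has_value p f c := residue s_size M s_uniq.

Lemma lift_add u v : sigma (u + v) = sigma u + sigma v.
Proof. by rewrite /fibre_act mulmxDr map_mxD. Qed.

Lemma lift_scale f v : sigma (f *: v) = iota f *: sigma v.
Proof. by rewrite /fibre_act -scalemxAr map_mxZ. Qed.

Lemma lift_sub u v : sigma (u - v) = sigma u - sigma v.
Proof. by rewrite /fibre_act mulmxBr map_mxB. Qed.

Lemma lift_involutive v : sigma (sigma v) = v.
Proof.
have [_ HH _] := liftH; rewrite /fibre_act !map_mxM.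
have iiM n m (A : 'M[X]_(n, m)) : map_mx iota (map_mx iota A) = A.
  by apply/matrixP => i j; rewrite !mxE inv_involutive.
by rewrite !iiM mulmxA HH mul1mx.
Qed.

Lemma lift_stalk p v : E p v -> E (inv_point iota p) (sigma v).
Proof.
move=> Ev; have [[_ /(_ p)] HE _ _] := liftH.
have : [set H *m v | v in E p] (H *m v) by exists v.
rewrite -HE => -[u Eu uH]; rewrite /fibre_act -uH.
rewrite (_ : map_mx _ _ = u) //; apply/matrixP => i j; by rewrite !mxE inv_involutive.
Qed.

Lemma inf_twist_inv_point p : theta (inv_point iota p) = theta p.
Proof. by rewrite /inf_twist /= (model_var M). Qed.

Lemma inf_twist_inv p : iota (theta p) = theta p.
Proof. by rewrite /inf_twist; case: ifP; rewrite ?rmorph1 // fmorphV (model_var M). Qed.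

Lemma lift_sections v : sections v -> sections (sigma v).
Proof.
move=> sv p; have := lift_stalk (sv (inv_point iota p)).
by rewrite inv_pointK lift_scale inf_twist_inv_point inf_twist_inv.
Qed.

Definition eigensection e v := [/\ sections v, v != 0 & sigma v = cst e *: v].

Lemma mpow_constM p n e f : e != 0 -> mpow p n (cst e * f) <-> mpow p n f.
Proof.
move=> e0; split=> [ef|]; last by apply: mpow0M; exact: mpow_const.
rewrite -[f](mulKf (x := cst e)) ?fmorph_eq0 //; apply: mpow0M => //.
by rewrite -fmorphV; exact: mpow_const.
Qed.

Lemma ord_sub_infinite p a : ord p x < 0 -> ord p (x - cst a) = -1.
Proof.
move=> px; have a_uniq : uniq [:: a] by [].
by have := ord_prod_inf s_uniq s_size M a_uniq px; rewrite big_seq1.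
Qed.

(* Vanishing at a non-Weierstrass point [p] forces vanishing at [iota p], hence a
   subbundle of degree at least [0]; vanishing at a Weierstrass point [w] gives a
   section of [E(w)], because the polar divisor of [x] is equivalent to [2w]. *)
Lemma eigensection_nonvanishing e v : e != 0 -> eigensection e v ->
  forall p, vanishing_order E v p (- inf p).
Proof.
move=> e0 [sv v0 ev].
have /choice[n nP] : forall p, exists n, vanishing_order E v p n.
  by move=> p; have [n [_ [_ [_ _ _ _ vn]]]] := saturation vE p v0; exists n.
have n_ge p : - inf p <= n p.
  have := proj1 (nP p (theta p)) (sv p).
  by rewrite mpow_ord ?(inf_twist_neq0 M) // (ord_inf_twist s_size M); lia.
(* [sigma] exchanges the stalks at [q] and [iota q] and multiplies [v] by a nonzero constant, so [v]
   vanishes to the same order at both. *)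
have n_inv p : n (inv_point iota p) = n p.
  have le q : n q <= n (inv_point iota q).
    have [t qt] := ord_onto q.
    have t0 : t != 0 by apply/eqP => t0; move: qt; rewrite t0 ord_zero.
    have : mpow q (- n q) (t ^ (- n q)) by right; rewrite ordXz // qt mul1r.
    move/(nP q) => /lift_stalk; rewrite lift_scale ev scalerA mulrC => /(nP _).
    rewrite mpow_constM // mpow_ord ?fmorph_eq0 ?expfz_neq0 //=.
    by rewrite inv_involutive ordXz // qt mul1r lerN2.
  by apply/eqP; rewrite eq_le le -{2}[p](inv_pointK iota) le.
suff nE p : n p = - inf p by move=> p; rewrite -nE.
apply/eqP; rewrite eq_le n_ge andbT leNgt; apply/negP => np.
have [ip|/eqP ip] := eqVneq (inv_point iota p) p.
  have /(weierstrassP s_size M s_uniq)[a as_ xp] : weierstrass iota p by [].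
  have [oxa _ _ uq] := finite_branch M s_uniq as_ xp.
  have xa0 := model_sub_neq0 M a.
  apply: (gunningE ip); exists ((x - cst a)^-1 *: v).
  split; first by rewrite scaler_eq0 invr_eq0 (negPf xa0).
  move=> q; rewrite /twist /= coeffU mul1r; have [pq|pq] := eqVneq p q.
    have [t qt] := ord_onto p; have t0 : t != 0 by apply/eqP => t0; move: qt; rewrite t0 ord_zero.
    rewrite -pq; exists t^-1, (t *: ((x - cst a)^-1 *: v)); split.
    - by right; rewrite ordV qt.
    - rewrite scalerA; apply/(nP p); right; rewrite ord_divf // qt oxa.
      by move: np; rewrite (inf_mult_finite M xp); lia.
    - by rewrite scalerA mulVf ?scale1r.
  exists 1, ((x - cst a)^-1 *: v); rewrite scale1r; split=> //.
    by right; rewrite ord_one.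
  apply/(nP q); right; rewrite ordV lerN2; apply: le_trans (n_ge q).
  have [[b xq]|qneg] := point_cases M q; last by rewrite ord_sub_infinite // inf_mult_inf.
  rewrite (inf_mult_finite M xq) (ord_sub_finite xq) //.
  by apply: contra_neq pq => ba; rewrite (uq q) // -ba.
have [l1 l1P] := almost_everywhere_standard vE.
have [l2 l2P] := finite_support_all s_uniq s_size M regularE (v 0 0).
have [l3 l3P] := finite_support_all s_uniq s_size M regularE (v 1 0).
have [D DE] : exists D : divisor X, forall q, coeff q D = n q.
  apply: (@divisor_of _ _ _ (l1 ++ l2 ++ l3)) => q; rewrite !mem_cat !negb_or.
  case/and3P => /l1P/standard_frame gq /l2P o0 /l3P o1.
  suff : - n q = 0 by lia.
  apply: (@mpow_inj _ _ q) => f; rewrite -(nP q f) (frame_mem _ gq).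
  have rowE' i : functional (row i (invmx 1%:M)) (f *: v) = f * v i 0.
    by rewrite functionalZ invmx1 rowE mulmx1 /functional -rowE mxE.
  split=> [fi|f0 i]; last first.
    rewrite rowE'; apply: mpow0M => //; right.
    by have [->|->] := ord2_cases i; rewrite ?o0 ?o1.
  have unit_mul (a : X) : a != 0 -> ord q a = 0 -> mpow q 0 (f * a) -> mpow q 0 f.
    by move=> a0 oa fa; rewrite -(mulfK a0 f); apply: mpowM0 => //; right; rewrite ordV oa.
  have := fi 0; have := fi 1; rewrite !rowE' => f1 f0.
  have [v00|v00] := eqVneq (v 0 0) 0; last exact: unit_mul f0.
  have [v10|v10] := eqVneq (v 1 0) 0; last exact: unit_mul f1.
  case/eqP: v0; apply/matrixP => i j; rewrite !ord1 mxE.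
  by have [->|->] := ord2_cases i.
have [pinf xpinf] := exists_infinite_point M regularE.
have [_ _ ipinf uinf _] := model_infinity s_size M xpinf.
(* [D] is here the divisor of [v]. Its coefficients are at least [- inf], with one to spare at the
   distinct points [p] and [iota p]; this compensates the two points at infinity and gives
   [deg D >= 0]. *)
have : 0 <= deg (D + << pinf >> + << inv_point iota pinf >> - << p >> - << inv_point iota p >>).
  apply: deg_ge0 => q; rewrite !coeffB !coeffD !coeffU !mul1r DE.
  have -> : n q + (pinf == q)%:R + (inv_point iota pinf == q)%:R = n q + inf q.
    rewrite -addrA; congr (_ + _); have [qneg|qpos] := ltP (ord q x) 0.
      rewrite (inf_mult_inf qneg); have [->|->] := uinf q qneg; rewrite eqxx.
        by rewrite (negPf (introN eqP ipinf)).
      by rewrite eq_sym (negPf (introN eqP ipinf)).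
    rewrite /inf_mult ltNge qpos /=.
    have -> : (pinf == q) = false by apply/eqP => pq; move: qpos; rewrite -pq leNgt xpinf.
    have -> : (inv_point iota pinf == q) = false.
      by apply/eqP => pq; move: qpos; rewrite -pq /= (model_var M) leNgt xpinf.
    by [].
  have := n_ge q; have [pq|_] := eqVneq p q.
    by rewrite -pq (negPf (introN eqP ip)) => _; lia.
  by have [pq|_] := eqVneq (inv_point iota p) q; rewrite -?pq ?n_inv ?(inf_mult_inv_point M) //; lia.
rewrite (degB (D + << pinf >> + << inv_point iota pinf >> - << p >>) << inv_point iota p >>).
rewrite (degB (D + << pinf >> + << inv_point iota pinf >>) << p >>).
rewrite (degD (D + << pinf >>) << inv_point iota pinf >>) (degD D << pinf >>) !degU => degD0.
have := stE (saturated_line_subbundle vE v0) (saturated_line_degree v0 nP DE).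
move=> /(_ 0); have det0 : bundle_degree E 0 by exists 0; split=> //; exact: deg0.
by move=> /(_ det0); lia.
Qed.

Lemma eigensection_comb e v1 v2 (c1 c2 : k) : e != 0 -> eigensection e v1 -> eigensection e v2 ->
  cst c1 *: v1 + cst c2 *: v2 != 0 -> eigensection e (cst c1 *: v1 + cst c2 *: v2).
Proof.
move=> e0 [s1 _ E1] [s2 _ E2] v0; split=> //.
  move=> p; rewrite scalerDr !scalerA ![theta p * _]mulrC -!scalerA; apply: bundle_add => //.
    by apply: bundle_scale => //; exact: mpow_const.
  by apply: bundle_scale => //; exact: mpow_const.
by rewrite lift_add !lift_scale E1 E2 !inv_const scalerDr !scalerA ![cst e * _]mulrC.
Qed.

Lemma weierstrass_sections w v : weierstrass iota w -> sections v -> E w v.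
Proof.
move=> /(weierstrassP s_size M s_uniq)[a as_ xw] /(_ w).
rewrite /inf_twist; case: ifP => [xneg|]; last by rewrite scale1r.
by have := inf_mult_inf xneg; rewrite (inf_mult_finite M xw).
Qed.

Lemma weierstrass_inf w : weierstrass iota w -> inf w = 0.
Proof. by move=> /(weierstrassP s_size M s_uniq)[a as_ xw]; rewrite (inf_mult_finite M xw). Qed.

(** As [v] does not vanish at [w], its multiples in [E_w] are by regular functions; if
    [cst c *: v = f *: u] with [f] in [m_w] and [c != 0], then [f^-1 * cst c] would be one of
    negative order. *)
Lemma eigensection_fibre e v w c : e != 0 -> eigensection e v -> weierstrass iota w ->
  maximal_stalk E w (cst c *: v) -> c = 0.
Proof.
move=> e0 ev ww [f [u [fw uw E0]]]; have := eigensection_nonvanishing e0 ev w.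
rewrite (weierstrass_inf ww) oppr0 => vn; apply/eqP/negPn/negP => c0.
have cn0 : cst c != 0 by rewrite fmorph_eq0.
have [f0|f0] := eqVneq f 0.
  move/eqP: E0; rewrite f0 scale0r scaler_eq0 (negPf cn0) /=.
  by have [_ /negPf->] := ev.
have : E w ((f^-1 * cst c) *: v) by rewrite -scalerA E0 scalerA mulVf ?scale1r.
move/vn; rewrite oppr0 mpow_ord ?mulf_neq0 ?invr_neq0 // ord_mul ?invr_neq0 // ordV ord_const.
by move: fw; rewrite /maximal_ideal mpow_ord //; lia.
Qed.

Lemma lift_maximal_stalk w u : weierstrass iota w ->
  maximal_stalk E w u -> maximal_stalk E w (sigma u).
Proof.
move=> ww [f [z [fw zw ->]]]; exists (iota f), (sigma z); split.
- by apply/mpow_inv_point; rewrite [inv_point _ _]ww.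
- by rewrite -[w]ww; apply: lift_stalk.
- by rewrite lift_scale.
Qed.

Lemma exists_weierstrass : exists w, weierstrass iota w.
Proof.
have [a as_] : exists a, a \in s.
  by case: s s_size => // a s' _; exists a; rewrite mem_head.
have [p xp] := exists_finite_point M regularE a.
by exists p; apply/(weierstrassP s_size M s_uniq); exists a.
Qed.

Lemma two_constP e : e ^+ 2 = 1 -> e = 1 \/ e = -1.
Proof. by move/eqP; rewrite sqrf_eq1 => /orP[]/eqP; [left|right]. Qed.

Lemma opposite_eigenvector e w : e ^+ 2 = 1 -> weierstrass iota w ->
  exists u, [/\ E w u, ~ maximal_stalk E w u & maximal_stalk E w (sigma u + cst e *: u)].
Proof.
move=> e2 ww; have [_ _ /(_ w ww)[Vp Vm]] := liftH.
suff [u [Eu u0 ue]] : eigenvalue_at iota E H (- e) w.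
  exists u; split=> //; first by move=> mu; apply: u0; apply/(fibre_classP vE); rewrite subr0.
  by move/(fibre_classP vE): ue; rewrite rmorphN scaleNr opprK.
by have [->|->] := two_constP e2; rewrite ?opprK.
Qed.

(* Two independent eigensections would span the fibre at a Weierstrass point. *)
Lemma eigensection_unique e v1 v2 : e ^+ 2 = 1 -> eigensection e v1 -> eigensection e v2 ->
  exists2 c, c != 0 & v2 = cst c *: v1.
Proof.
move=> e2 E1 E2; have e0 : e != 0 by rewrite -sqrf_eq0 e2 oner_eq0.
have [w ww] := exists_weierstrass.
apply: contrapT => nprop.
have free (c1 c2 : k) : cst c1 *: v1 + cst c2 *: v2 = 0 -> c1 = 0 /\ c2 = 0.
  move=> c12; have [_ v10 _] := E1; have [_ v20 _] := E2.
  have [c20|c20] := eqVneq c2 0.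
    split=> //; move/eqP: c12; rewrite c20 rmorph0 scale0r addr0 scaler_eq0 (negPf v10) orbF.
    by rewrite fmorph_eq0 => /eqP.
  have v2E : v2 = cst (- c1 / c2) *: v1.
    rewrite rmorphM rmorphN fmorphV /=; apply: (scalerI (a := cst c2)).
      by rewrite fmorph_eq0.
    rewrite scalerA mulrC divfK ?fmorph_eq0 // scaleNr; apply/eqP.
    by rewrite -addr_eq0 addrC c12.
  case: nprop; exists (- c1 / c2) => //; apply: contra_neq v20 => c0.
  by rewrite v2E c0 rmorph0 scale0r.
have [u [Eu u0 ue]] := opposite_eigenvector e2 ww.
have [||c1 c2 c12|c1 [c2 uc]] := fibre_basis vE (@residueX w) (v1 := v1) (v2 := v2) _ _ Eu.
- by apply: weierstrass_sections => //; case: E1.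
- by apply: weierstrass_sections => //; case: E2.
- have [c0|c0] := eqVneq (cst c1 *: v1 + cst c2 *: v2) 0; first exact: free.
  have ec := eigensection_comb e0 E1 E2 c0.
  have /eqP : (1 : k) = 0 by apply: (eigensection_fibre e0 ec ww); rewrite rmorph1 scale1r.
  by rewrite oner_eq0.
set z := cst c1 *: v1 + cst c2 *: v2 in uc.
have zE : sigma z = cst e *: z.
  have [_ _ h1] := E1; have [_ _ h2] := E2.
  by rewrite /z lift_add !lift_scale h1 h2 !inv_const scalerDr !scalerA ![cst e * _]mulrC.
apply: u0; have suz := lift_maximal_stalk ww uc.
have sE : sigma (u - z) = sigma u - cst e *: z by rewrite lift_sub zE.
(* In the fibre at [w], [u] is an eigenvector for [- e] and equals [z], an eigenvector for [e];
   hence [2 e u] is zero there. *)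
have : maximal_stalk E w (cst (2 * e) *: u).
  rewrite (_ : _ *: u = (sigma u + cst e *: u) - sigma (u - z) + cst e *: (u - z)); last first.
    rewrite sE rmorphM rmorph_nat; apply/matrixP => i j; rewrite !mxE; ring.
  apply: maximal_stalkD => //; first exact: maximal_stalkB.
  by apply: maximal_stalkZ => //; exact: mpow_const.
move=> mu; have -> : u = cst (2 * e)^-1 *: (cst (2 * e) *: u).
  rewrite scalerA -rmorphM mulVf ?rmorph1 ?scale1r // mulf_neq0 // pnatr_eq0 //.
by apply: maximal_stalkZ => //; exact: mpow_const.
Qed.

(** [b + e sigma b] is fixed up to the factor [e]. If it vanished for both members of a free pair of
    sections, both would be eigensections for [- e], against uniqueness up to constants. *)
Lemma eigensection_exists e : e ^+ 2 = 1 -> exists v, eigensection e v.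
Proof.
move=> e2; have [b [bfree bs]] : dim_ge sections 2.
  exact: (riemann_inequality s_uniq s_size M regularE vE detE).
have b_neq0 i : b i != 0.
  apply/eqP => b0; have /bfree /(_ i) /eqP : \sum_(j < 2) cst ((j == i)%:R) *: b j = 0.
    by rewrite (bigD1 i) //= b0 scaler0 big1 ?addr0 // => j /negPf ->; rewrite rmorph0 scale0r.
  by rewrite eqxx oner_eq0.
apply: contrapT => nov; have eigen i : eigensection (- e) (b i).
  split=> //; have ee : cst e * cst e = 1 by rewrite -rmorphM -expr2 e2 rmorph1.
  have w0 : b i + cst e *: sigma (b i) = 0.
    apply: contrapT => /eqP w0; case: nov; exists (b i + cst e *: sigma (b i)); split=> //.
      move=> p; rewrite scalerDr; apply: bundle_add => //; first exact: bs.
      rewrite scalerA mulrC -scalerA; apply: bundle_scale => //; first exact: mpow_const.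
      exact: lift_sections (bs i) p.
    by rewrite lift_add lift_scale inv_const lift_involutive scalerDr scalerA ee scale1r addrC.
  move/eqP: w0; rewrite addr_eq0 => /eqP bE.
  by rewrite [in RHS]bE rmorphN scaleNr scalerN opprK scalerA ee scale1r.
have e2' : (- e) ^+ 2 = 1 by rewrite sqrrN.
have [c c0 b10] := eigensection_unique e2' (eigen 0) (eigen 1).
have /bfree /(_ 1) : \sum_(i < 2) cst (if i == 0 then c else -1) *: b i = 0.
  rewrite !big_ord_recl big_ord0 (_ : fintype.lift ord0 ord0 = 1); last exact: val_inj.
  by rewrite /= b10 rmorphN1 scaleN1r addr0 subrr.
by move=> /eqP; rewrite /= oppr_eq0 oner_eq0.
Qed.

Definition eigenline v : sheaf X 2 := fun p => [set w | exists f, mpow p (inf p) f /\ w = f *: v].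

Section Eigenline.
Variables (e : k) (v : 'cV[X]_2).
Hypotheses (e2 : e ^+ 2 = 1) (ev : eigensection e v).

Let e_neq0 : e != 0. Proof. by rewrite -sqrf_eq0 e2 oner_eq0. Qed.
Let v_neq0 : v != 0. Proof. by case: ev. Qed.

Lemma eigenline_stalk p f : E p (f *: v) <-> mpow p (inf p) f.
Proof. by have := eigensection_nonvanishing e_neq0 ev p f; rewrite opprK. Qed.

Lemma eigenline_saturated : eigenline v = saturated_line E v.
Proof.
apply/funext => p; apply/seteqP; split=> [w [f [fp wE]]|w [Ew [f wE]]]; last first.
  by exists f; split=> //; apply/eigenline_stalk; rewrite -wE.
by split; [rewrite wE; apply/eigenline_stalk|exists f].
Qed.

Lemma eigenline_subbundle : line_subbundle E (eigenline v).
Proof. by rewrite eigenline_saturated; apply: saturated_line_subbundle. Qed.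

Lemma eigenline_iso (KX : divisor X) (G : X) : G != 0 ->
  (forall p, coeff p KX = ord p G + inf p) -> isomorphic (line_bundle (- KX)) (eigenline v).
Proof.
move=> G0 KE; exists (G^-1 *: v); split.
  move=> c; rewrite [c]mx11_scalar mul_mx_scalar => /eqP.
  rewrite !scaler_eq0 invr_eq0 (negPf G0) (negPf v_neq0) !orbF => /eqP ->.
  by apply/matrixP => i j; rewrite !mxE mul0rn.
move=> p; apply/seteqP; split=> [_ [f [fp ->]]|_ [c cp <-]].
  exists (f * G)%:M; last by rewrite mul_mx_scalar scalerA mulfK.
  rewrite /line_bundle /= mxE eqxx mulr1n coeffN opprK KE addrC.
  by apply: mpowM => //; right.
rewrite [c]mx11_scalar mul_mx_scalar scalerA; exists (c 0 0 / G); split=> //.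
move: cp; rewrite /line_bundle /= coeffN opprK KE => cp.
rewrite (_ : inf p = ord p G + inf p - ord p G); last by ring.
by apply: mpowM => //; right; rewrite ordV.
Qed.

Lemma eigenline_invariant : invariant_under iota H (eigenline v).
Proof.
have [_ _ sE] := ev.
have HE u : H *m u = map_mx iota (sigma u).
  by apply/matrixP => i j; rewrite [RHS]mxE [X in _ = iota X]mxE inv_involutive.
move=> p; apply/seteqP; split=> [_ [_ [f [fp ->]] <-]|_ [_ [f [fp ->]] <-]].
  rewrite HE lift_scale sE scalerA; exists ((iota f * cst e) *: v) => //.
  exists (iota f * cst e); split=> //; rewrite (inf_mult_inv_point M) mulrC mpow_constM //.
  by apply/mpow_inv_point; rewrite inv_involutive.
rewrite (inf_mult_inv_point M) in fp.
exists ((cst e * iota f) *: v).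
  exists (cst e * iota f); split=> //; rewrite mpow_constM //; exact/mpow_inv_point.
rewrite HE lift_scale sE scalerA rmorphM inv_const inv_involutive.
by rewrite mulrAC -rmorphM -expr2 e2 rmorph1 mul1r.
Qed.

Lemma eigenline_scale c : c != 0 -> eigenline (cst c *: v) = eigenline v.
Proof.
move=> c0; have cn0 : cst c != 0 by rewrite fmorph_eq0.
apply/funext => p; apply/seteqP; split=> _ [f [fp ->]].
  by exists (cst c * f); rewrite mpow_constM // scalerA mulrC.
exists (cst c^-1 * f); rewrite mpow_constM ?invr_eq0 // scalerA fmorphV mulrAC mulVf // mul1r.
by [].
Qed.

End Eigenline.

(** Equal lines would give [v1 = f *: v2] with [f] regular everywhere, hence constant, and the two
    eigenvalues would agree. *)
Lemma eigenline_neq v1 v2 : eigensection 1 v1 -> eigensection (-1) v2 ->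
  eigenline v1 <> eigenline v2.
Proof.
move=> E1 E2 L12; have [s1 v10 h1] := E1; have [s2 v20 h2] := E2.
have mem p : exists f, mpow p 0 f /\ v1 = f *: v2.
  have : eigenline v1 p (theta p *: v1).
    by exists (theta p); split=> //; right; rewrite (ord_inf_twist s_size M).
  have t0 := inf_twist_neq0 M p.
  rewrite L12 => -[f [fp fE]]; exists (f / theta p); split.
    rewrite -(subrr (inf p)); apply: mpowM => //.
    by right; rewrite ordV (ord_inf_twist s_size M).
  by rewrite mulrC -scalerA -fE scalerA mulVf // scale1r.
have [p0 _] := exists_finite_point M regularE 0; have [f [_ vE0]] := mem p0.
have [p|c fc] := regularE (f := f).
  have [g [gp /eqP]] := mem p; rewrite vE0 -subr_eq0 -scalerBl scaler_eq0 (negPf v20) orbF.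
  by rewrite subr_eq0 => /eqP ->.
move: h1; rewrite vE0 fc lift_scale inv_const h2 rmorph1 scale1r scalerA mulrC rmorphN1 mulN1r.
move/eqP; rewrite scaleNr -subr_eq0 -opprD oppr_eq0 -mulr2n -scaler_nat scaler_eq0.
rewrite (negPf (two_neq0 X)) /= -fc -vE0; by rewrite (negPf v10).
Qed.

(* An invariant line is spanned by a section [v], and [sigma v = u v] where [u]
   is regular everywhere, hence constant. *)
Lemma invariant_line_eigen (KX : divisor X) (G : X) (L : sheaf X 2) : G != 0 ->
  (forall p, coeff p KX = ord p G + inf p) ->
  line_subbundle E L -> isomorphic (line_bundle (- KX)) L -> invariant_under iota H L ->
  exists e v, [/\ e ^+ 2 = 1, eigensection e v & L = eigenline v].
Proof.
(* Since [KX] is the divisor of [G] plus the polar divisor [D] of [x], rescaling the generator [A]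
   by [G] presents [L] as [O(-D) v]. *)
move=> G0 KE [_ Lsub] [A [Ainj LA]] Linv; pose v : 'cV[X]_2 := G *: A.
have A0 : A != 0.
  apply/eqP => A0; have /matrixP/(_ 0 0)/eqP : (1%:M : 'M[X]_1) = 0.
    by apply: Ainj; rewrite A0 mul0mx.
  by rewrite !mxE oner_eq0.
have v0 : v != 0 by rewrite scaler_eq0 (negPf G0).
have LE : L = eigenline v.
  apply/funext => p; rewrite LA; apply/seteqP; split=> [_ [c cp <-]|_ [f [fp ->]]].
    exists (c 0 0 / G); rewrite [X in A *m X]mx11_scalar mul_mx_scalar scalerA divfK //; split=> //.
    move: cp; rewrite /line_bundle /= coeffN opprK KE => cp.
    rewrite (_ : inf p = ord p G + inf p - ord p G); last by ring.
    by apply: mpowM => //; right; rewrite ordV.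
  exists (f * G)%:M; last by rewrite mul_mx_scalar -scalerA.
  rewrite /line_bundle /= mxE eqxx mulr1n coeffN opprK KE addrC.
  by apply: mpowM => //; right.
have tv p : L p (theta p *: v).
  by rewrite LE; exists (theta p); split=> //; right; rewrite (ord_inf_twist s_size M).
have sv : sections v.
  move=> p; have [g [gE Lg]] := Lsub p; move: (tv p); rewrite Lg => -[a ap <-].
  by apply: bundle_scale => //; exact: frame_col.
have mem p : exists f, mpow (inv_point iota p) 0 f /\ sigma v = f *: v.
  have : [set H *m w | w in L p] (H *m (theta p *: v)) by exists (theta p *: v).
  have t0 := inf_twist_neq0 M p.
  rewrite Linv LE => -[_ [f [fp ->]] fE]; exists (f / theta p); split.
    rewrite -(subrr (inf (inv_point iota p))); apply: mpowM => //.
    by right; rewrite ordV -inf_twist_inv_point (ord_inf_twist s_size M).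
  have : sigma (theta p *: v) = f *: v.
    by rewrite /fibre_act -fE; apply/matrixP => i j; rewrite !mxE inv_involutive.
  rewrite lift_scale inf_twist_inv => E1.
  by rewrite mulrC -scalerA -E1 scalerA mulVf // scale1r.
have [p0 _] := exists_finite_point M regularE 0; have [f [_ fE]] := mem p0.
have [p|e fe] := regularE (f := f).
  have [g [gp /eqP]] := mem (inv_point iota p); rewrite inv_pointK in gp.
  by rewrite fE -subr_eq0 -scalerBl scaler_eq0 (negPf v0) orbF subr_eq0 => /eqP ->.
exists e, v; split=> //; last by split=> //; rewrite fE fe.
have /eqP : sigma (sigma v) = v := lift_involutive v.
rewrite {1}fE fe lift_scale inv_const fE fe scalerA -subr_eq0 -{2}[v]scale1r -scalerBl.
rewrite scaler_eq0 (negPf v0) orbF -rmorphM -(rmorph1 cst) -rmorphB fmorph_eq0 subr_eq0.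
by rewrite -expr2 => /eqP.
Qed.

(** The values of [v1] and [v2] at [w] form a basis of the fibre on which [h] is diagonal with
    entries [e] and [- e], so the eigenspace for [e] is spanned by that of [v1]. *)
Lemma eigenline_fibre e v1 v2 w : e ^+ 2 = 1 -> eigensection e v1 -> eigensection (- e) v2 ->
  weierstrass iota w -> eigenspace_at iota E H e w = subfibre E (eigenline v1) w.
Proof.
move=> e2 E1 E2 ww; have [s1 v10 h1] := E1; have [s2 v20 h2] := E2.
have e0 : e != 0 by rewrite -sqrf_eq0 e2 oner_eq0.
have e0' : - e != 0 by rewrite oppr_eq0.
have e2n0 : 2 * e != 0 by rewrite mulf_neq0 // pnatr_eq0.
have v1w := weierstrass_sections ww s1; have v2w := weierstrass_sections ww s2.
(* Applying [sigma - e] kills the component along [v1] and multiplies the other by [- 2 e], which is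
   nonzero. *)
have comb c1 c2 : sigma (cst c1 *: v1 + cst c2 *: v2) - cst e *: (cst c1 *: v1 + cst c2 *: v2)
    = - (cst (2 * e * c2) *: v2).
  rewrite lift_add !lift_scale !inv_const h1 h2 !rmorphM rmorphN rmorph_nat.
  by apply/matrixP => i j; rewrite !mxE; ring.
have c2_0 c2 : maximal_stalk E w (- (cst (2 * e * c2) *: v2)) -> c2 = 0.
  rewrite -scaleNr -rmorphN => /(eigensection_fibre e0' E2 ww) /eqP.
  by rewrite oppr_eq0 mulf_eq0 (negPf e2n0) => /eqP.
apply/seteqP; split=> [_ [u [uw ue] <-]|_ [_ [f [fp ->]] <-]]; last first.
  rewrite (weierstrass_inf ww) in fp; exists (f *: v1) => //; split.
    exact: bundle_scale.
  apply/(fibre_classP vE); rewrite lift_scale h1 !scalerA.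
  have [c fc] := residueX fp.
  have ifc : has_value w (iota f) c by apply: value_of_inv_point; rewrite [inv_point _ _]ww.
  (* [iota] fixes [w], so [f] and [iota f] have the same value there and their difference lies in
     [m_w]. *)
  exists ((iota f - f) * cst e), v1; split=> //.
    apply: mpowM0 (mpow_const _ _); rewrite (_ : iota f - f = (iota f - cst c) - (f - cst c)).
      exact: mpowB.
    by ring.
  by rewrite -scalerBl; congr (_ *: _); ring.
have [c1 c2 c12|c1 [c2 uc]] := fibre_basis vE (@residueX w) v1w v2w uw.
  have c20 : c2 = 0.
    apply: c2_0; rewrite -(comb c1); apply: maximal_stalkB => //.
      exact: lift_maximal_stalk.
    by apply: maximal_stalkZ => //; exact: mpow_const.
  split=> //; move: c12; rewrite c20 rmorph0 scale0r addr0.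
  exact: eigensection_fibre e0 E1 ww.
have c20 : c2 = 0.
  apply: c2_0; rewrite -(comb c1); set z := cst c1 *: v1 + cst c2 *: v2 in uc *.
  have -> : sigma z - cst e *: z = (sigma u - cst e *: u) - (sigma (u - z) - cst e *: (u - z)).
    by rewrite lift_sub; apply/matrixP => i j; rewrite !mxE; ring.
  apply: maximal_stalkB => //; first exact/(fibre_classP vE).
  apply: maximal_stalkB => //; first exact: lift_maximal_stalk.
  by apply: maximal_stalkZ => //; exact: mpow_const.
exists (cst c1 *: v1).
  by exists (cst c1); rewrite (weierstrass_inf ww); split=> //; exact: mpow_const.
apply/esym/(fibre_classP vE); move: uc; by rewrite c20 rmorph0 scale0r addr0.
Qed.

End EigenSections.

(** * The two invariant lines and their fibres *)

Lemma invariant_lines (k : numClosedFieldType) (X : curve k) (hX : genus X 2)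
    (KX : divisor X) (hKX : canonical_divisor KX)
    (iota : involution X) (hiota : hyperelliptic iota)
    (E : sheaf X 2) (hE : vector_bundle E) (hst : stable E) (hdet : trivial_determinant E)
    (hG : forall w : closed_point X, weierstrass iota w -> ~ odd_gunning_plane E w)
    (H : 'M[X]_2) (hH : is_lift iota E H) :
  exists Lp Lm : sheaf X 2,
    [/\ Lp <> Lm,
        (forall L : sheaf X 2,
           [/\ line_subbundle E L, isomorphic (line_bundle (- KX)) L
             & invariant_under iota H L] <-> (L = Lp \/ L = Lm))
      & forall w : closed_point X, weierstrass iota w ->
          eigenspace_at iota E H 1 w = subfibre E Lp w /\
          eigenspace_at iota E H (- 1) w = subfibre E Lm w].
Proof.
have [D [_ dimD]] := hX; have regularE f := @regular_const _ _ _ _ f dimD.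
have [x [y [s [m [s_uniq s_size M]]]]] := model_even hiota.
have m3 := genus_two_branch s_uniq s_size M regularE hX; subst m.
have [G G0 KE'] := canonical_formula s_uniq s_size M regularE hKX.
(* For [m = 3] the factor [m - 2] is 1: the canonical divisor is equivalent to the polar divisor of
   [x]. *)
have {KE'} KE p : coeff p KX = ord p G + inf_mult x p by rewrite KE'; ring.
have e1 : (1 : k) ^+ 2 = 1 by rewrite expr1n.
have em1 : (-1 : k) ^+ 2 = 1 by rewrite sqrrN expr1n.
have [vp Ep] := eigensection_exists s_uniq s_size M regularE hE hst hdet hG hH e1.
have [vm Em] := eigensection_exists s_uniq s_size M regularE hE hst hdet hG hH em1.
exists (eigenline x vp), (eigenline x vm); split.
- exact: (eigenline_neq s_size M regularE Ep Em).
- move=> L; split=> [[Lsub Liso Linv]|].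
    have [e [v [e2 Ev ->]]] :=
      invariant_line_eigen s_size M regularE hE hH G0 KE Lsub Liso Linv.
    have [eE|eE] := two_constP e2; rewrite eE in Ev; [left|right].
      have [c c0 ->] := eigensection_unique s_uniq s_size M regularE hE hst hdet hG hH e1 Ep Ev.
      by rewrite eigenline_scale.
    have [c c0 ->] := eigensection_unique s_uniq s_size M regularE hE hst hdet hG hH em1 Em Ev.
    by rewrite eigenline_scale.
  have line e v : e ^+ 2 = 1 -> eigensection iota x E H e v ->
      [/\ line_subbundle E (eigenline x v), isomorphic (line_bundle (- KX)) (eigenline x v)
        & invariant_under iota H (eigenline x v)].
    move=> e2 Ev; split.
    - exact: (eigenline_subbundle s_uniq s_size M regularE hE hst hdet hG hH e2 Ev).
    - exact: (eigenline_iso Ev G0 KE).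
    - exact: (eigenline_invariant M e2 Ev).
  by case=> ->; [apply: line e1 Ep|apply: line em1 Em].
move=> w ww; split.
  exact: (eigenline_fibre s_uniq s_size M regularE hE hst hdet hG hH e1 Ep Em ww).
(* With [e = -1] the roles are exchanged: the section for the opposite sign is now [vp]. *)
have Ep' : eigensection iota x E H (- -1) vp by rewrite opprK.
exact: (eigenline_fibre s_uniq s_size M regularE hE hst hdet hG hH em1 Em Ep' ww).
Qed.

Unset Implicit Arguments.
Local Open Scope complex_scope.

Theorem corollary4p4 (R : realType) (X : curve R[i]) (hX : genus X 2)
    (KX : divisor X) (hKX : canonical_divisor KX)
    (iota : involution X) (hiota : hyperelliptic iota)
    (E : sheaf X 2) (hE : vector_bundle E) (hst : stable E)
    (hdet : trivial_determinant E)
    (hG : forall w : closed_point X, weierstrass iota w -> ~ odd_gunning_plane E w)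
    (H : 'M[X]_2) (hH : is_lift iota E H) :
  exists Lp Lm : sheaf X 2,
    [/\ Lp <> Lm,
        (forall L : sheaf X 2,
           [/\ line_subbundle E L, isomorphic (line_bundle (- KX)) L
             & invariant_under iota H L] <-> (L = Lp \/ L = Lm))
      & forall w : closed_point X, weierstrass iota w ->
          eigenspace_at iota E H 1 w = subfibre E Lp w /\
          eigenspace_at iota E H (- 1) w = subfibre E Lm w].
Proof. exact: (@invariant_lines R[i] X hX KX hKX iota hiota E hE hst hdet hG H hH). Qed.
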